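(* Let $X$ be a finite simplicial complex with $\dim X=d$, let $A$ be a subcomplex of $X$, and let $0\le k\le d$. Then $\mathcal{F}_k(X,A)\neq\emptyset$ and $\mathcal{T}_k(X,A)\subseteq\mathcal{F}_k(X,A)$. Moreover, $\mathcal{T}_k(X,A)\neq\emptyset$ if and only if $\beta_{k-1}(X,A)=0$. In this case (i.e. if $\beta_{k-1}(X,A)=0$), letting $\beta=\beta_{k-2}(X,A)$: (i) The product of all nonzero eigenvalues (with multiplicity) of $L^{\mathrm{ud}}_{k-1}(X,A)$ is equal to $$\sum_{\Upsilon\in\mathcal{T}_k(X,A)}|H_{k-1}(\Upsilon,A_{(k)})|^2\cdot\sum_{\Gamma\in\mathcal{F}_{k-1}(X,A)}\frac{|H_{k-2}(\Gamma,A_{(k-1)})/\mathbb{Z}^{\beta}|^2}{|H_{k-2}(X,A)/\mathbb{Z}^{\beta}|^2}.$$ (ii) For any $\Gamma\in\mathcal{F}_{k-1}(X,A)$, $$\sum_{\Upsilon\in\mathcal{T}_k(X,A)}|H_{k-1}(\Upsilon,A_{(k)})|^2=\frac{|H_{k-2}(X,A)/\mathbb{Z}^{\beta}|^2}{|H_{k-2}(\Gamma,A_{(k-1)})/\mathbb{Z}^{\beta}|^2}\,\det L^{\mathrm{ud}}_{k-1}(X,\Gamma).$$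
   Context: A (finite) simplicial complex $X$ is a finite collection of finite sets closed under taking subsets, always containing $\emptyset$. Its elements are faces, $\dim\sigma=|\sigma|-1$, $X_k$ is the set of $k$-dimensional faces, $V(X)$ is the union of all faces, $\dim X$ is the maximal dimension of a face, and $X_{(p)}$ is the subcomplex of all faces of dimension at most $p$. A subcomplex of $X$ is a subset that is itself a simplicial complex. A complex pair $(X,A)$ is a simplicial complex $X$ with a subcomplex $A$. Fix a total order on $V(X)$. For a commutative ring $R$, $C_k(X,A;R)=C_k(X;R)/C_k(A;R)$ is identified with the free $R$-module on $X_k\setminus A_k$; for $\sigma=\{v_0\prec\dots\prec v_k\}\in X_k\setminus A_k$, the relative boundary map $\partial_k(X,A;R):C_k(X,A;R)\to C_{k-1}(X,A;R)$ sends $[\sigma]$ to $\sum_i(-1)^i[\sigma\setminus\{v_i\}]$, the sum being over those $i$ with $\sigma\setminus\{v_i\}\notin A_{k-1}$. Here $C_{-1}(X,A;R)=0$ since $\emptyset\in A$. Set $H_k(X,A;R)=\ker\partial_k/\operatorname{im}\partial_{k+1}$, $H_k(X,A)=H_k(X,A;\mathbb{Z})$, let $\beta_k(X,A)$ be the rank of the free part of $H_k(X,A)$, and $f_k(X,A)=|X_k\setminus A_k|$. Groups in dimension $<0$ are $0$. $L^{\mathrm{ud}}_k(X,A)=\partial_{k+1}(X,A;\mathbb{R})\,\partial_{k+1}(X,A;\mathbb{R})^{\top}$, a real matrix with rows and columns indexed by $X_k\setminus A_k$. Empty products and determinants of $0\times 0$ matrices equal $1$. For $k\le d$, let $\Upsilon$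 be a simplicial complex with $A_{(k)}\subseteq\Upsilon\subseteq X_{(k)}$. $\Upsilon$ is a $k$-dimensional relative spanning forest of $(X,A)$ if $\Upsilon_{(k-1)}=X_{(k-1)}$ and (a) $\beta_k(\Upsilon,A_{(k)})=0$, (b) $\beta_{k-1}(\Upsilon,A_{(k)})=\beta_{k-1}(X,A)$, (c) $f_k(\Upsilon,A_{(k)})=f_k(X,A)-\beta_k(X_{(k)},A_{(k)})$. It is a $k$-dimensional relative spanning tree of $(X,A)$ if $\Upsilon_{(k-1)}=X_{(k-1)}$ and (a), (c) hold together with (b$^*$) $\beta_{k-1}(\Upsilon,A_{(k)})=0$ in place of (b). $\mathcal{F}_k(X,A)$ and $\mathcal{T}_k(X,A)$ denote the sets of $k$-dimensional relative spanning forests and trees respectively (for $k=-1$ the only forest is $\{\emptyset\}$). For a finitely generated abelian group $H$ whose free part has rank $\beta$, $H/\mathbb{Z}^\beta$ denotes the quotient by a free direct summand of rank $\beta$, so $|H/\mathbb{Z}^\beta|$ is the order of the torsion subgroup of $H$. *)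

(* Defs.v *)
From HB Require Import structures.
From mathcomp Require Import all_boot all_order all_algebra.
From mathcomp Require Import ring_quotient finmap.
From mathcomp Require Import boolp classical_sets cardinality reals.

Set Implicit Arguments.
Unset Strict Implicit.
Unset Printing Implicit Defensive.

Import Order.TTheory GRing.Theory Num.Theory.
Local Open Scope ring_scope.

(* Vertices live in a finite totally ordered type T, whose order induces the
   one on V(X) (not all of T need be used). Dimensions are integers, so that
   the empty face has dimension -1 and k - 1, k - 2 are not truncated. *)

Definition simplicial_complex (T : finType) (X : {set {set T}}) : bool :=
  (finset.set0 \in X) && [forall s in X, powerset s \subset X].

Definition subcomplex (T : finType) (A X : {set {set T}}) : bool :=
  simplicial_complex A && (A \subset X).

Definition face_dim (T : finType) (s : {set T}) : int := #|s|%:Z - 1.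

Definition complex_dim (T : finType) (X : {set {set T}}) : int :=
  (\max_(s in X) #|s|)%:Z - 1.

Definition skeleton (T : finType) (X : {set {set T}}) (p : int) :
  {set {set T}} := [set s in X | face_dim s <= p]%SET.

Definition rel_faces (T : finType) (X A : {set {set T}}) (k : int) :
  {set {set T}} := [set s in X :\: A | face_dim s == k]%SET.

Definition fcount (T : finType) (X A : {set {set T}}) (k : int) : nat :=
  #|rel_faces X A k|.

(* Matrix of the relative boundary map C_k(X,A;R) -> C_l(X,A;R) for l = k - 1,
   acting on column vectors. The target dimension l is a separate parameter
   only because k + 1 - 1 and k are not convertible (for l <> k - 1 the matrix
   is zero). The sign exponent is the position of v among the vertices of s. *)
Definition boundary (disp : Order.disp_t) (T : finOrderType disp)
    (R : comNzRingType) (X A : {set {set T}}) (l k : int) :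
    'M[R]_(#|rel_faces X A l|, #|rel_faces X A k|) :=
  \matrix_(i, j)
    let t : {set T} := enum_val i in let s : {set T} := enum_val j in
    \sum_(v in s | s :\ v == t) (-1) ^+ #|[set u in s | (u < v)%O]%SET|.

Definition cycles (R : comNzRingType) (m n : nat) (M : 'M[R]_(m, n)) :
  {pred 'cV[R]_n} := [pred v | M *m v == 0].

Lemma cycles_zmod_closed (R : comNzRingType) (m n : nat) (M : 'M[R]_(m, n)) :
  zmod_closed (cycles M).
Proof.
split=> [|u v]; rewrite !inE ?mulmx0 // => /eqP uM /eqP vM.
by rewrite mulmxBr uM vM subrr.
Qed.

HB.instance Definition _ (R : comNzRingType) (m n : nat) (M : 'M[R]_(m, n)) :=
  GRing.isZmodClosed.Build 'cV[R]_n (cycles M) (cycles_zmod_closed M).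

Definition cycle_group (R : comNzRingType) (m n : nat) (M : 'M[R]_(m, n)) :=
  {v : 'cV[R]_n | v \in cycles M}.

HB.instance Definition _ (R : comNzRingType) (m n : nat) (M : 'M[R]_(m, n)) :=
  [isSub of cycle_group M for sval].
HB.instance Definition _ (R : comNzRingType) (m n : nat) (M : 'M[R]_(m, n)) :=
  [Choice of cycle_group M by <:].
HB.instance Definition _ (R : comNzRingType) (m n : nat) (M : 'M[R]_(m, n)) :=
  [SubChoice_isSubZmodule of cycle_group M by <:].

Definition boundaries (R : comNzRingType) (m n p : nat) (M : 'M[R]_(m, n))
    (N : 'M[R]_(n, p)) : {pred cycle_group M} :=
  fun z => `[< exists w : 'cV[R]_p, val z = N *m w >].
Arguments boundaries {R m n p} M N.

Lemma boundaries_zmod_closed (R : comNzRingType) (m n p : nat)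
    (M : 'M[R]_(m, n)) (N : 'M[R]_(n, p)) : zmod_closed (boundaries M N).
Proof.
split=> [|x y /asboolP[u xu] /asboolP[v yv]]; apply/asboolP.
  by exists 0; rewrite mulmx0 raddf0.
by exists (u - v); rewrite mulmxBr -xu -yv raddfB.
Qed.

HB.instance Definition _ (R : comNzRingType) (m n p : nat) (M : 'M[R]_(m, n))
    (N : 'M[R]_(n, p)) :=
  GRing.isZmodClosed.Build (cycle_group M) (boundaries M N)
    (boundaries_zmod_closed M N).

Definition homology_of (R : comNzRingType) (m n p : nat) (M : 'M[R]_(m, n))
    (N : 'M[R]_(n, p)) : zmodType :=
  Quotient.quot (boundaries M N).

Definition homology (disp : Order.disp_t) (T : finOrderType disp)
    (R : comNzRingType) (X A : {set {set T}}) (k : int) : zmodType :=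
  homology_of (boundary R X A (k - 1) k) (boundary R X A k (k + 1)).

Definition torsion (H : zmodType) : set H :=
  [set x | exists2 n : nat, (0 < n)%N & x *+ n = 0]%classic.

(* H is the internal direct sum of a free subgroup f(Z^r) and its torsion
   subgroup (their intersection is trivial because f is injective). *)
Definition has_free_rank (H : zmodType) (r : nat) : Prop :=
  exists2 f : {additive 'cV[int]_r -> H},
    injective f & forall x : H, exists y : 'cV[int]_r, torsion (x - f y).

Definition free_rank (H : zmodType) : nat :=
  xget 0%N [set r | has_free_rank H r]%classic.

(* Both orders below are 0 when the underlying set is infinite. *)
Definition group_order (H : zmodType) : nat :=
  #|` fset_set [set: H]%classic|%fset.

(* The order of H / Z^beta, beta the rank of the free part of H. *)
Definition torsion_order (H : zmodType) : nat :=
  #|` fset_set (@torsion H)|%fset.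

Definition betti (disp : Order.disp_t) (T : finOrderType disp)
    (X A : {set {set T}}) (k : int) : nat := free_rank (homology int X A k).

Definition forests (disp : Order.disp_t) (T : finOrderType disp)
    (X A : {set {set T}}) (k : int) : {set {set {set T}}} :=
  [set U : {set {set T}} |
    [&& simplicial_complex U, skeleton A k \subset U, U \subset skeleton X k,
        skeleton U (k - 1) == skeleton X (k - 1),
        betti U (skeleton A k) k == 0%N,
        betti U (skeleton A k) (k - 1) == betti X A (k - 1) &
        (fcount U (skeleton A k) k)%:Z
          == (fcount X A k)%:Z
             - (betti (skeleton X k) (skeleton A k) k)%:Z]]%SET.

Definition trees (disp : Order.disp_t) (T : finOrderType disp)
    (X A : {set {set T}}) (k : int) : {set {set {set T}}} :=
  [set U : {set {set T}} |
    [&& simplicial_complex U, skeleton A k \subset U, U \subset skeleton X k,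
        skeleton U (k - 1) == skeleton X (k - 1),
        betti U (skeleton A k) k == 0%N,
        betti U (skeleton A k) (k - 1) == 0%N &
        (fcount U (skeleton A k) k)%:Z
          == (fcount X A k)%:Z
             - (betti (skeleton X k) (skeleton A k) k)%:Z]]%SET.

Definition up_down_laplacian (disp : Order.disp_t) (T : finOrderType disp)
    (R : realType) (X A : {set {set T}}) (k : int) :
    'M[R]_#|rel_faces X A k| :=
  boundary R X A k (k + 1) *m (boundary R X A k (k + 1))^T.

(* s lists the eigenvalues of M with algebraic multiplicity. *)
Definition eigenvalue_list (R : realType) (n : nat) (M : 'M[R]_n)
    (s : seq R) : Prop := char_poly M = \prod_(a <- s) ('X - a%:P).

(* Main.v *)
From HB Require Import structures.
From mathcomp Require Import fingroup perm ring_quotient finmap.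
From mathcomp Require Import boolp classical_sets cardinality.
From mathcomp.real_closed Require Import complex.
Require Import Defs.
From mathcomp Require Import all_boot all_order all_algebra zify.
From mathcomp Require Import reals.

(** Only linear algebra over the integers is involved. Let N and M be the
    relative boundary matrices in dimensions k - 1 and k, so that N M = 0.

    A complex U between the skeleta of dimension k - 1 and k is determined by
    its relative k-faces, that is, by a set of columns of M, and reading the
    three Betti numbers as ranks shows that U is a forest exactly when these
    columns form a basis of the column space of M (mem_forests). Hence forests
    exist, and the trees are the forests if the Betti number of (X, A) in
    dimension k - 1 is zero, while there is no tree otherwise (mem_trees).

    By the Smith normal form M = B E Z, where B has a left inverse, Z has a
    right inverse and E is square and nonsingular. The torsion of ker N / im M
    is then im B / im (B E), which has order |det E| (torsion_order_factor).
    Restricting M to the columns of a forest replaces Z by a square submatrix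
    Z_U, so that the torsion of the forest has order |det E| |det Z_U|, and by
    Cauchy-Binet the squares of these orders add up to det E ^ 2 det (Z Z^T)
    (sum_forests_torsion_order).

    Let now the Betti number in dimension k - 1 be zero, and write N = B E C.
    If the columns of K are a basis of ker N, then M = K P, where the rank of
    M is the number of rows of P. In dimension k the previous paragraph
    applies with E = 1 and Z = P and gives the sum over trees as det (P P^T).
    In dimension k - 1 it shows that the torsion of a forest G divided by that
    of (X, A) is |det C_G|. Since C and K are the two maps of a split exact
    sequence, Jacobi's identity for complementary minors gives
    det C_G ^ 2 = det K_Q ^ 2, where Q consists of the (k-1)-faces outside of G
    (complementary_minors).

    Both formulas follow. The Laplacian of (X, G) is (K_Q P) (K_Q P)^T, of
    determinant det K_Q ^ 2 det (P P^T). The Laplacian of (X, A) is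
    K (P P^T K^T), which has the same nonzero eigenvalues as the nonsingular
    matrix P P^T K^T K, and det (K^T K) = det (C C^T) is the sum over forests
    of the squared torsion ratios (det_split_exact_gram). *)
Set Implicit Arguments.
Unset Strict Implicit.
Unset Printing Implicit Defensive.
Import Order.TTheory GRing.Theory Num.Theory.
Local Open Scope ring_scope.

(** * Smith normal form, split exact sequences and rational rank *)

(** The sequence 0 -> Z^r -> Z^n -> Z^s -> 0 with maps K and C is exact, and K'
    and C' split it. *)
Definition split_exact (r n s : nat) (K : 'M[int]_(n, r))
    (C : 'M[int]_(s, n)) :=
  n = (r + s)%N /\
  exists (K' : 'M[int]_(r, n)) (C' : 'M[int]_(n, s)),
    [/\ K' *m K = 1%:M, C *m C' = 1%:M, C *m K = 0, K' *m C' = 0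
      & K *m K' + C' *m C = 1%:M].

Lemma split_exact_tr (r n s : nat) (K : 'M[int]_(n, r)) (C : 'M[int]_(s, n)) :
  split_exact K C -> split_exact C^T K^T.
Proof.
case=> n_def [K' [C' [K'K CC' CK K'C' KC]]]; split; first by rewrite addnC.
exists C'^T, K'^T; split.
- by rewrite -trmx_mul CC' trmx1.
- by rewrite -trmx_mul K'K trmx1.
- by rewrite -trmx_mul CK trmx0.
- by rewrite -trmx_mul K'C' trmx0.
- by rewrite -!trmx_mul -raddfD /= addrC KC trmx1.
Qed.

Lemma split_exact_unit (r s : nat) (L R : 'M[int]_(r + s)) :
  R *m L = 1%:M -> split_exact (lsubmx L) (dsubmx R).
Proof.
move=> RL; split=> //; exists (usubmx R), (rsubmx L).
have LR := mulmx1C RL.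
move: RL LR; rewrite -{1 2}[R]vsubmxK -{1 2}[L]hsubmxK mul_col_row mul_row_col.
rewrite {1}scalar_mx_block => /eq_block_mx[-> -> -> ->].
by rewrite addrC => ->; split.
Qed.

(** The zero divisors of the Smith normal form are dropped: what remains of the
    left factor is a basis of the saturation of the column space of M, and the
    discarded columns of the inverse of the right factor are a basis of the
    kernel of M. *)
Lemma smith_split (m n : nat) (M : 'M[int]_(m, n)) :
  exists (rk c r : nat) (B : 'M[int]_(m, rk)) (Q : 'M[int]_(c, m))
    (e : 'rV[int]_rk) (C : 'M[int]_(rk, n)) (K : 'M[int]_(n, r)),
  [/\ split_exact B Q, split_exact K C, forall i, e 0 i != 0
    & M = B *m diag_mx e *m C].
Proof.
have [L L_unit [R R_unit [d d_sorted ->]]] := int_Smith_normal_form M.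
(* The zeros of d come last, since each entry divides the next one. *)
pose rk := minn (minn m n) (index 0 d).
have m_def : m = (rk + (m - rk))%N.
  by rewrite subnKC // /rk -minnA geq_minl.
have n_def : n = (rk + (n - rk))%N.
  by rewrite subnKC // /rk (minnC m) -minnA geq_minl.
have d0 i : (i < m)%N -> (i < n)%N -> (rk <= i)%N -> d`_i = 0.
  move=> im jn; rewrite geq_min leqNgt leq_min im jn /= => di.
  case: (ltnP i (size d)) => [ilt|/(nth_default 0)//].
  apply/eqP; rewrite -dvd0z.
  have id : (index 0%R d < size d)%N by apply: leq_ltn_trans di ilt.
  have := sorted_leq_nth (@dvdz_trans) dvdzz 0 d_sorted _ _ id ilt di.
  by rewrite nth_index // -index_mem.
have dN0 i : (i < rk)%N -> d`_i != 0.
  by rewrite leq_min => /andP[_ di]; apply/negbT/(before_find 0 di).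
move: (m - rk)%N (n - rk)%N m_def n_def => c r m_def n_def.
clearbody rk; subst m n.
exists rk, c, r, (lsubmx L), (dsubmx (invmx L)), (\row_i d`_i), (usubmx R).
exists (rsubmx (invmx R)); split.
- by apply: split_exact_unit; rewrite mulVmx.
- rewrite -[usubmx R]trmxK -[rsubmx _]trmxK; apply: split_exact_tr.
  rewrite trmx_usub trmx_rsub; apply: split_exact_unit.
  by rewrite -trmx_mul mulmxV ?trmx1.
- by move=> i; rewrite mxE dN0.
set D := \matrix_(i, j) _.
have -> : D = block_mx (diag_mx (\row_i d`_i)) 0 0 0.
  apply/matrixP=> i j; rewrite mxE.
  case: (splitP i) => i' ei; case: (splitP j) => j' ej; rewrite ei ej.
  - have -> : i = lshift c i' by apply: val_inj.
    have -> : j = lshift r j' by apply: val_inj.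
    by rewrite block_mxEul !mxE.
  - have -> : i = lshift c i' by apply: val_inj.
    have -> : j = rshift rk j' by apply: val_inj.
    by rewrite block_mxEur !mxE ltn_eqF // ltn_addr.
  - have -> : i = rshift rk i' by apply: val_inj.
    have -> : j = lshift r j' by apply: val_inj.
    by rewrite block_mxEdl !mxE gtn_eqF // ltn_addr.
  have -> : i = rshift rk i' by apply: val_inj.
  have -> : j = rshift rk j' by apply: val_inj.
  rewrite block_mxEdr !mxE; case: eqP => // eij.
  rewrite d0 ?leq_addr //.
    by rewrite ltn_add2l.
  by rewrite eij ltn_add2l.
rewrite -{1}[L]hsubmxK -{1}[R]vsubmxK mul_row_block !mulmx0 !addr0.
by rewrite mul_row_col mul0mx addr0.
Qed.

(** B and the diagonal matrix are injective, so N and C have the same kernel,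
    which is the column space of K by exactness. *)
Lemma smith_kernel (m n rk r : nat) (N : 'M[int]_(m, n)) (B : 'M[int]_(m, rk))
    (B' : 'M[int]_(rk, m)) (e : 'rV[int]_rk) (C : 'M[int]_(rk, n))
    (K : 'M[int]_(n, r)) :
  B' *m B = 1%:M -> (forall i, e 0 i != 0) -> split_exact K C ->
  N = B *m diag_mx e *m C ->
  forall q (z : 'M_(n, q)), N *m z = 0 -> exists z', z = K *m z'.
Proof.
move=> B'B e0 [_ [K' [C' [_ _ _ _ KK']]]] Ndef q z Nz; exists (K' *m z).
have BeCz : B *m (diag_mx e *m (C *m z)) = 0 by rewrite !mulmxA -Ndef.
have eCz : diag_mx e *m (C *m z) = 0.
  by rewrite -[LHS]mul1mx -B'B -mulmxA BeCz mulmx0.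
have Cz : C *m z = 0.
  apply/matrixP => i j; move/matrixP/(_ i j)/eqP: eCz.
  by rewrite mul_diag_mx !mxE mulf_eq0 (negPf (e0 i)) => /eqP.
rewrite mulmxA -[LHS]mul1mx -KK' mulmxDl.
by rewrite -[C' *m C *m z]mulmxA Cz mulmx0 addr0.
Qed.

Lemma absz_det_inverse (r : nat) (X Y : 'M[int]_r) :
  X *m Y = 1%:M -> `|\det X|%N = 1%N.
Proof.
move=> /(congr1 (absz \o determinant)) /=; rewrite det_mulmx det1 abszM.
by move/eqP; rewrite muln_eq1 => /andP[/eqP].
Qed.

Definition qrank (m n : nat) (M : 'M[int]_(m, n)) : nat :=
  \rank (map_mx intr M : 'M[rat]_(m, n)).

Lemma det_neq0_qrank (n : nat) (E : 'M[int]_n) : (\det E != 0) = (qrank E == n).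
Proof.
rewrite -[_ == n]/(row_free _) row_free_unit unitmxE unitfE det_map_mx.
by rewrite intr_eq0.
Qed.

(** E is recovered from B E G by multiplying with the one-sided inverses, so no
    rank is lost. *)
Lemma qrank_factor (m n r : nat) (B : 'M[int]_(m, r)) (B' : 'M[int]_(r, m))
    (E : 'M[int]_r) (G : 'M[int]_(r, n)) (G' : 'M[int]_(n, r)) :
  B' *m B = 1%:M -> G *m G' = 1%:M -> \det E != 0 -> qrank (B *m E *m G) = r.
Proof.
move=> B'B GG' E_unit; apply/eqP; rewrite eqn_leq; apply/andP; split.
  rewrite /qrank map_mxM; apply: leq_trans (mxrankM_maxr _ _) _.
  exact: rank_leq_row.
have rkE : qrank E = r by apply/eqP; rewrite -det_neq0_qrank.
have -> : B *m E *m G = B *m (E *m G) by rewrite mulmxA.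
have EE : E = B' *m (B *m (E *m G)) *m G'.
  by rewrite 2!mulmxA B'B mul1mx -mulmxA GG' mulmx1.
rewrite -{1}rkE {1}EE /qrank map_mxM (map_mxM _ B').
apply: leq_trans (mxrankM_maxl _ _) _; exact: mxrankM_maxr.
Qed.

Lemma diag_det_neq0 (r : nat) (e : 'rV[int]_r) :
  (forall i, e 0 i != 0) -> \det (diag_mx e) != 0.
Proof. by move=> e0; rewrite det_diag; apply/prodf_neq0 => i _. Qed.

Lemma qrank_smith (m n rk r c : nat) B Q K C (e : 'rV[int]_rk)
    (M := B *m diag_mx e *m C) :
  @split_exact rk m c B Q -> @split_exact r n rk K C ->
  (forall i, e 0 i != 0) -> qrank M = rk.
Proof.
move=> [_ [B' [_ [B'B _ _ _ _]]]] [_ [_ [C' [_ CC' _ _ _]]]] /diag_det_neq0.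
exact: qrank_factor B'B CC'.
Qed.

(** The kernel basis of the Smith form has n minus rank many elements, hence at
    least one. *)
Lemma kernel_vector (m n : nat) (M : 'M[int]_(m, n)) :
  (m < n)%N -> exists2 v : 'cV[int]_n, v != 0 & M *m v = 0.
Proof.
move=> lt_mn.
have [rk [c [r [B [Q [e [C [K [[mE _] KC _ ->]]]]]]]]] := smith_split M.
have [nE [K' [C' [K'K CC' CK _ _]]]] := KC.
have r_gt0 : (0 < r)%N.
  rewrite lt0n; apply: contraTneq lt_mn => r0.
  by rewrite -leqNgt mE nE r0 add0n leq_addr.
pose j := Ordinal r_gt0; exists (K *m delta_mx j (0 : 'I_1)); last first.
  by rewrite -mulmxA (mulmxA C) CK mul0mx mulmx0.
apply/negP => /eqP /(congr1 (mulmx K')).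
rewrite mulmxA K'K mul1mx mulmx0 => /matrixP/(_ j 0).
by rewrite !mxE !eqxx.
Qed.

Lemma rank_factorization (m n : nat) (M : 'M[int]_(m, n)) :
  exists (c r : nat) (B : 'M[int]_(m, qrank M)) (Q : 'M[int]_(c, m))
    (e : 'rV[int]_(qrank M)) (C : 'M[int]_(qrank M, n)) (K : 'M[int]_(n, r)),
  [/\ split_exact B Q, split_exact K C, forall i, e 0 i != 0
    & M = B *m diag_mx e *m C].
Proof.
have [rk [c [r [B [Q [e [C [K [BQ KC e0 Mdef]]]]]]]]] := smith_split M.
have rkM : qrank M = rk by rewrite Mdef (qrank_smith BQ KC).
by subst rk; exists c, r, B, Q, e, C, K.
Qed.

(** * Free rank and torsion of a homology group of integer matrices *)

Section HomologyClass.
Local Open Scope quotient_scope.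
Variables (m n p : nat) (N : 'M[int]_(m, n)) (M : 'M[int]_(n, p)).

Definition hclass (z : cycle_group N) : homology_of N M :=
  \pi_(homology_of N M) z.

Lemma hclass_is_zmod_morphism : zmod_morphism hclass.
Proof. exact: raddfB. Qed.
HB.instance Definition _ :=
  GRing.isZmodMorphism.Build _ _ hclass hclass_is_zmod_morphism.

Lemma hclass_eq (x y : cycle_group N) :
  hclass x = hclass y <-> exists w, val x - val y = M *m w.
Proof.
rewrite -raddfB; have e : (x - y \in boundaries N M) = (hclass x == hclass y).
  exact: Quotient.idealrBE.
split=> [/eqP | /asboolP xy]; first by rewrite -e => /asboolP.
by apply/eqP; rewrite -e.
Qed.

Lemma hclass_surj (x : homology_of N M) : exists z, x = hclass z.
Proof. by exists (repr x); rewrite /hclass reprK. Qed.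

Lemma hclass_eq0 (z : cycle_group N) :
  hclass z = 0 <-> exists w, val z = M *m w.
Proof. by rewrite -(raddf0 hclass) hclass_eq [val 0](raddf0 val) subr0. Qed.

Lemma torsion_hclass (z : cycle_group N) :
  torsion (hclass z) <->
  exists2 k : nat, (0 < k)%N & exists w, val z *+ k = M *m w.
Proof.
have e k : hclass z *+ k = 0 <-> exists w, val z *+ k = M *m w.
  by rewrite -raddfMn hclass_eq0 [val (z *+ k)](raddfMn val).
by split=> -[k k0 /e ?]; exists k.
Qed.

Section Span.
Variables (r : nat) (K : 'M[int]_(n, r)) (NK : N *m K = 0).

Lemma mul_cycles (y : 'cV_r) : K *m y \in cycles N.
Proof. by rewrite inE mulmxA NK mul0mx. Qed.

Definition span_class (y : 'cV_r) : homology_of N M :=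
  hclass (exist _ (K *m y) (mul_cycles y)).

Lemma span_class_is_zmod_morphism : zmod_morphism span_class.
Proof.
move=> x y; rewrite -raddfB; congr hclass; apply: val_inj.
by rewrite [RHS](raddfB val); apply: mulmxBr.
Qed.
HB.instance Definition _ :=
  GRing.isZmodMorphism.Build _ _ span_class span_class_is_zmod_morphism.
End Span.

End HomologyClass.

Lemma mxscale_int_inj (m n : nat) (k : nat) (A B : 'M[int]_(m, n)) :
  (0 < k)%N -> A *+ k = B *+ k -> A = B.
Proof.
move=> k0 /matrixP AB; apply/matrixP=> i j.
have := AB i j; rewrite !mulmxnE => /eqP.
by rewrite eqrMn2r eqn0Ngt k0 /= => /eqP.
Qed.

Lemma additive_cV_sum (H : zmodType) (r : nat)
    (f : {additive 'cV[int]_r -> H}) (v : 'cV_r) :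
  f v = \sum_i f (delta_mx i 0) *~ v i 0.
Proof.
rewrite [v in LHS]matrix_sum_delta raddf_sum; apply: eq_bigr => i _.
by rewrite big_ord1 -[v i 0 in LHS]intz scaler_int raddfMz.
Qed.

(** Otherwise express a multiple of the image of each basis vector of Z^r
    through the images of Z^s. This gives an integer matrix Z with fewer rows
    than columns, and a kernel vector of Z contradicts the injectivity of the
    map from Z^r. *)
Lemma free_rank_le (H : zmodType) (r s : nat) :
  has_free_rank H r -> has_free_rank H s -> (r <= s)%N.
Proof.
move=> [f f_inj _] [g _ gP]; rewrite leqNgt; apply/negP => lt_sr.
have [Y YP] := choice gP.
have /choice[k kP] : forall i : 'I_r, exists k : nat, (0 < k)%N /\
    f (delta_mx i 0) *+ k = g (Y (f (delta_mx i 0))) *+ k.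
  move=> i; have [k k0 e] := YP (f (delta_mx i 0)); exists k; split => //.
  by apply/eqP; rewrite -subr_eq0 -mulrnBl e.
(* A common multiple of the orders of all the differences. *)
pose k_ := (\prod_i k i)%N.
have kf i : f (delta_mx i 0) *+ k_ = g (Y (f (delta_mx i 0))) *+ k_.
  by rewrite /k_ (bigD1 i) //= !mulrnA; have [_ ->] := kP i.
have k_gt0 : (0 < k_)%N by rewrite prodn_gt0 // => i; have [] := kP i.
pose Z : 'M[int]_(s, r) := \matrix_(i, j) Y (f (delta_mx j 0)) i 0.
have fZ (v : 'cV_r) : f v *+ k_ = g (Z *m v) *+ k_.
  rewrite (additive_cV_sum f) -[g _]/((g \o mulmx Z) v) additive_cV_sum.
  rewrite -!sumrMnl; apply: eq_bigr => i _.
  rewrite !pmulrn !(mulrzAC _ (v i 0)) -!pmulrn kf.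
  congr (g _ *+ _ *~ _); apply/colP => j.
  by rewrite /= -colE !mxE.
have [v v0 Zv] := kernel_vector Z lt_sr.
move: (fZ v); rewrite Zv raddf0 mul0rn -raddfMn -(raddf0 f) => /f_inj.
rewrite -(mul0rn _ k_) => /mxscale_int_inj v_eq0.
by rewrite v_eq0 ?eqxx in v0.
Qed.

Lemma free_rankE (H : zmodType) (r : nat) :
  has_free_rank H r -> free_rank H = r.
Proof.
move=> Hr; rewrite /free_rank; case: xgetP => [s _ Hs|/(_ r)//].
by apply/eqP; rewrite eqn_leq !(@free_rank_le H).
Qed.

(** Multiplication by the adjugate solves the system up to the factor det E. *)
Lemma det_annihilates (r : nat) (E : 'M[int]_r) (y : 'cV_r) :
  \det E != 0 -> exists2 k : nat, (0 < k)%N & exists u, y *+ k = E *m u.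
Proof.
move=> E0; exists `|\det E|%N; first by rewrite absz_gt0.
exists (Num.sg (\det E) *: (\adj E *m y)).
rewrite -scalemxAr mulmxA mul_mx_adj mul_scalar_mx scalerA -normrEsg -abszE.
by rewrite -[X in X *: _]intz scaler_int.
Qed.

Section Homology.
Variables (m n p : nat) (N : 'M[int]_(m, n)) (M : 'M[int]_(n, p)).
Hypothesis NM0 : N *m M = 0.

(** Let K be a basis of ker N, and write M = K M'. A complement of the
    saturation of the column space of M' maps onto the homology modulo torsion,
    and its dimension is the dimension of ker N minus the rank of M. *)
Lemma has_free_rank_homology :
  exists2 c, has_free_rank (homology_of N M) c & (c + qrank N + qrank M = n)%N.
Proof.
have [rk [c [r [B [Q [e [C [K [BQ KC e0 Ndef]]]]]]]]] := smith_split N.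
have rkN : qrank N = rk by rewrite Ndef (qrank_smith BQ KC).
have [_ [B' [_ [B'B _ _ _ _]]]] := BQ.
have [n_def [K' [C' [K'K CC' CK K'C' KK']]]] := KC.
have NK : N *m K = 0 by rewrite Ndef -mulmxA CK mulmx0.
have Nker := smith_kernel B'B e0 KC Ndef.
have [M' MK] := Nker _ _ NM0.
have := smith_split M'.
move=> [rk' [c' [r' [B2 [Q2 [e2 [C2 [K2 [BQ2 KC2 e20 Mdef]]]]]]]]].
have [_ [_ [C2' [_ CC2' _ _ _]]]] := KC2.
have [r_def [B2' [Q2' [B2B QQ QB BQ' BQ1]]]] := BQ2.
have rkM : qrank M = rk'.
  rewrite MK Mdef 2!mulmxA.
  apply: (@qrank_factor _ _ _ _ (B2' *m K') _ _ C2') => //.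
    by rewrite mulmxA -[B2' *m K' *m K]mulmxA K'K mulmx1.
  exact: diag_det_neq0.
suff Hc : has_free_rank (homology_of N M) c'.
  by exists c'; rewrite // rkN rkM n_def r_def addnAC (addnC c').
have NKQ : N *m (K *m Q2') = 0 by rewrite mulmxA NK mul0mx.
exists (span_class M NKQ).
  move=> x y /hclass_eq[w /= xy].
  have : Q2 *m K' *m (K *m Q2' *m x - K *m Q2' *m y) = Q2 *m K' *m (M *m w).
    by rewrite xy.
  rewrite -mulmxBr -[K *m Q2' *m _]mulmxA mulmxA -(mulmxA Q2) K'K mulmx1.
  rewrite mulmxA QQ mul1mx mulmxA -[Q2 *m K' *m M]mulmxA MK (mulmxA K') K'K.
  rewrite mul1mx Mdef !mulmxA QB !mul0mx.
  by move/eqP; rewrite subr_eq0 => /eqP.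
move=> x; have [z ->] := hclass_surj x.
have [y zK] : exists y, val z = K *m y by apply: Nker; apply/eqP/(valP z).
exists (Q2 *m y); rewrite -raddfB; apply/torsion_hclass.
rewrite [val _](raddfB val) /=.
have -> : val z - K *m Q2' *m (Q2 *m y) = K *m (B2 *m (B2' *m y)).
  rewrite zK -mulmxA -mulmxBr; congr (_ *m _).
  by apply/eqP; rewrite subr_eq !mulmxA -mulmxDl BQ1 mul1mx.
have [k k0 [u uE]] := det_annihilates (B2' *m y) (diag_det_neq0 e20).
exists k => //; exists (C2' *m u).
by rewrite MK Mdef !mulmxA -(mulmxA _ C2) CC2' mulmx1 -!mulmxA -uE !raddfMn.
Qed.

Lemma free_rank_homology :
  (free_rank (homology_of N M) + qrank N + qrank M = n)%N.
Proof. by have [c /free_rankE ->] := has_free_rank_homology. Qed.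

Lemma group_order_torsion_order :
  free_rank (homology_of N M) = 0%N ->
  group_order (homology_of N M) = torsion_order (homology_of N M).
Proof.
have [c Hc _] := has_free_rank_homology; rewrite (free_rankE Hc) => c0.
rewrite c0 in Hc; have [f _ fP] := Hc; rewrite /group_order /torsion_order.
congr #|` fset_set _|; apply/seteqP; split=> // x _.
have [y] := fP x; suff -> : y = 0 by rewrite raddf0 subr0.
by apply/matrixP=> -[].
Qed.
End Homology.

Lemma card_fset_set_fin (U : choiceType) (I : finType) (f : I -> U)
    (A : set U) :
  injective f -> (forall x, A x <-> exists i, x = f i) ->
  #|` fset_set A| = #|I|.
Proof.
move=> f_inj fA; have -> : A = [set` [fset f i | i in I]%fset]%classic.
  apply/seteqP; split=> x /=.
    by move/fA=> [i ->]; apply/imfsetP; exists i.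
  by case/imfsetP=> i _ ->; apply/fA; exists i.
by rewrite set_fsetK card_imfset //= -cardE.
Qed.

Section TorsionOrder.
Variables (m n p r : nat) (N : 'M[int]_(m, n)) (M : 'M[int]_(n, p)).
Hypothesis NM0 : N *m M = 0.

(** The torsion consists of the classes of the columns B y, because B has a left
    inverse and so spans a saturated subgroup. Two such classes agree iff the
    coordinates of y agree modulo the entries of e, so the remainders are
    representatives. *)
Lemma torsion_order_diag (B : 'M[int]_(n, r)) (B' : 'M[int]_(r, n))
    (e : 'rV[int]_r) (G : 'M[int]_(r, p)) (G' : 'M[int]_(p, r)) :
  B' *m B = 1%:M -> G *m G' = 1%:M -> (forall i, e 0 i != 0) ->
  M = B *m diag_mx e *m G ->
  torsion_order (homology_of N M) = (\prod_i `|e 0%R i|)%N.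
Proof.
move=> B'B GG' e0 Mdef.
have NB : N *m B = 0.
  have /matrixP NBe : N *m B *m diag_mx e = 0.
    rewrite -[LHS]mulmx1 -GG' !mulmxA -(mulmxA N) -(mulmxA N) -Mdef.
    by rewrite NM0 mul0mx.
  apply/matrixP=> i j; have /eqP := NBe i j.
  by rewrite mul_mx_diag !mxE mulf_eq0 (negPf (e0 j)) orbF => /eqP.
pose I := {dffun forall i : 'I_r, 'I_`|e 0%R i|}.
pose f (k : I) := span_class M NB (\col_i (k i : nat)%:Z).
have f_eq (y y' : 'cV_r) : span_class M NB y = span_class M NB y' <->
    forall i, (e 0%R i %| y i 0%R - y' i 0%R)%Z.
  split=> [/hclass_eq[w /= yy'] i|dv].
    have : y - y' = diag_mx e *m (G *m w).
      rewrite -[LHS]mul1mx -B'B -mulmxA mulmxBr yy' Mdef.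
      by rewrite !mulmxA B'B mul1mx.
    move/matrixP/(_ i 0); rewrite mul_diag_mx !mxE => ->.
    exact: dvdz_mulr.
  apply/hclass_eq => /=.
  exists (G' *m \col_i ((y i 0%R - y' i 0%R) %/ e 0%R i)%Z).
  rewrite Mdef !mulmxA -(mulmxA _ G) GG' mulmx1 -mulmxBr -mulmxA.
  congr (_ *m _); apply/matrixP=> i j; rewrite ord1 mul_diag_mx !mxE.
  by rewrite mulrC divzK.
have f_inj : injective f.
  move=> k k' /f_eq kk'; apply/ffunP => i; apply/val_inj/eqP => /=.
  have := kk' i; rewrite !mxE -eqz_mod_dvd.
  rewrite -[X in X == _]modz_abs -[X in _ == X]modz_abs !modz_nat.
  by rewrite eqz_nat !modn_small.
have fP x : torsion x <-> exists k, x = f k.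
  split=> [|[k ->]]; last first.
    apply/torsion_hclass.
    have [q q0 [u uE]] :=
      det_annihilates (\col_i (k i : nat)%:Z) (diag_det_neq0 e0).
    exists q => //; exists (G' *m u).
    by rewrite Mdef -mulmxA (mulmxA G) GG' mul1mx -mulmxA -uE raddfMn.
  have [z ->] := hclass_surj x; move=> /torsion_hclass[q q0 [w zw]].
  have zB : val z = B *m (B' *m val z).
    apply: (@mxscale_int_inj _ _ q) => //.
    rewrite -[RHS](raddfMn (mulmx B)) -(raddfMn (mulmx B')) zw /=.
    by rewrite Mdef !mulmxA -(mulmxA B B') B'B mulmx1.
  set y := B' *m val z in zB.
  have lt_k i : (`|(y i 0%R %% e 0%R i)%Z| < `|e 0%R i|)%N.
    by rewrite -ltz_nat gez0_abs ?modz_ge0 // ltz_mod.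
  exists [ffun i => Ordinal (lt_k i)].
  have -> : hclass M z = span_class M NB y by congr hclass; apply: val_inj.
  apply/f_eq => i; rewrite [X in _ - X]mxE ffunE /= gez0_abs ?modz_ge0 //.
  by rewrite -eqz_mod_dvd modz_mod.
rewrite /torsion_order (card_fset_set_fin f_inj fP) card_dep_ffun.
rewrite foldrE big_map big_enum.
by apply: eq_bigr => i _; rewrite card_ord.
Qed.

(** The Smith form of E reduces to the diagonal case; its unimodular factors are
    absorbed into B and G. *)
Lemma torsion_order_factor (B : 'M[int]_(n, r)) (B' : 'M[int]_(r, n))
    (E : 'M[int]_r) (G : 'M[int]_(r, p)) (G' : 'M[int]_(p, r)) :
  B' *m B = 1%:M -> G *m G' = 1%:M -> \det E != 0 -> M = B *m E *m G ->
  torsion_order (homology_of N M) = `|\det E|%N.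
Proof.
move=> B'B GG' E0 Mdef.
have [rk [c [s [B0 [Q [e [C [K [BQ KC e0 Edef]]]]]]]]] := smith_split E.
have rkE : qrank E = r by apply/eqP; rewrite -det_neq0_qrank.
have rk_r : rk = r by rewrite -rkE Edef (qrank_smith BQ KC).
subst rk; have [_ [B0' [_ [B0B _ _ _ _]]]] := BQ.
have [_ [_ [C' [_ CC' _ _ _]]]] := KC.
rewrite (@torsion_order_diag (B *m B0) (B0' *m B') e (C *m G) (G' *m C')) //.
- rewrite Edef !det_mulmx !abszM (absz_det_inverse (mulmx1C B0B)).
  rewrite (absz_det_inverse CC') mul1n muln1 det_diag.
  by rewrite (big_morph absz abszM (erefl : `|1%R|%N = 1%N)).
- by rewrite mulmxA -(mulmxA B0') B'B mulmx1.
- by rewrite mulmxA -(mulmxA C) GG' mulmx1.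
by rewrite Mdef Edef !mulmxA.
Qed.
End TorsionOrder.

(** * Determinant identities *)

Lemma trmx_sub1_mul (n r q : nat) (h : 'I_r -> 'I_n) (A : 'M[int]_(n, q)) :
  (colsub h 1%:M)^T *m A = rowsub h A.
Proof.
by rewrite -[RHS]mul1mx trmx_mxsub trmx1 mul_rowsub_mx !mul1mx.
Qed.

(** Jacobi's identity. Put together the columns of K and the unit vectors
    selected by g. Multiplied by the inverse of the unimodular matrix (K C')
    this becomes block triangular with determinant the minor of C; multiplied
    by the permutation matrix of h and g it becomes block triangular with
    determinant the minor of K. *)
Lemma complementary_minors (r n s : nat) (K : 'M[int]_(n, r))
    (C : 'M[int]_(s, n)) (g : 'I_s -> 'I_n) (h : 'I_r -> 'I_n) :
  split_exact K C -> injective g -> injective h -> (forall i j, h i != g j) ->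
  \det (colsub g C) ^+ 2 = \det (rowsub h K) ^+ 2.
Proof.
case=> n_def [K' [C' [K'K CC' CK K'C' _]]] g_inj h_inj hg; subst n.
pose G : 'M[int]_(r + s, s) := colsub g 1%:M.
pose H : 'M[int]_(r + s, r) := colsub h 1%:M.
pose W := col_mx K' C; pose Z := row_mx K G; pose P := row_mx H G.
have WZ : \det W * \det Z = \det (colsub g C).
  rewrite -det_mulmx mul_col_row K'K CK det_ublock det1 mul1r.
  by rewrite /G mulmx_colsub mulmx1.
have sub1 (a b : nat) (f : 'I_a -> 'I_(r + s)) (f' : 'I_b -> 'I_(r + s)) i j :
    ((colsub f 1%:M)^T *m colsub f' 1%:M : 'M[int]_(a, b)) i j =
    (f i == f' j)%:R.
  by rewrite trmx_sub1_mul !mxE.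
have HG : H^T *m G = 0.
  by apply/matrixP=> i j; rewrite sub1 mxE (negPf (hg i j)).
have GG : G^T *m G = 1%:M.
  by apply/matrixP=> i j; rewrite sub1 mxE (inj_eq g_inj).
have HH : H^T *m H = 1%:M.
  by apply/matrixP=> i j; rewrite sub1 mxE (inj_eq h_inj).
have PZ : \det P^T * \det Z = \det (rowsub h K).
  rewrite -det_mulmx tr_row_mx mul_col_row HG GG det_lblock det1 mulr1.
  by rewrite trmx_sub1_mul.
have sqr1 (X Y : 'M[int]_(r + s)) : X *m Y = 1%:M -> \det X ^+ 2 = 1.
  move/absz_det_inverse => dX; rewrite -real_normK ?num_real // -abszE dX.
  exact: expr1n.
rewrite -WZ -PZ !exprMn (sqr1 W (row_mx K C')) ?(sqr1 P^T P) //.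
  rewrite tr_row_mx mul_col_row HG GG HH -[G^T *m H]trmxK trmx_mul trmxK HG.
  by rewrite trmx0 -scalar_mx_block.
by rewrite mul_col_row K'K CC' CK K'C' -scalar_mx_block.
Qed.

Section CauchyBinet.
Variables (R : numDomainType) (r n : nat) (A : 'M[R]_(r, n)).

(** Expanding the Leibniz formula of A A^T over all functions f gives the sum of
    prod_i A i (f i) times det (colsub f A). Averaging over the permutations of
    the rows turns the first factor into a second determinant. *)
Lemma det_mul_tr_ffun :
  \det (A *m A^T) *+ r`! =
  \sum_(f : {ffun 'I_r -> 'I_n}) \det (colsub f A) ^+ 2.
Proof.
have detE : \det (A *m A^T) =
    \sum_(f : {ffun 'I_r -> 'I_n}) (\prod_i A i (f i)) * \det (colsub f A).
  rewrite -det_tr; under eq_bigr do rewrite -det_tr.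
  rewrite /determinant; under [RHS]eq_bigr do rewrite mulr_sumr.
  rewrite exchange_big; apply: eq_bigr => s _ /=.
  transitivity ((-1) ^+ s *
      \prod_i \sum_j A i j * A (s i) j).
    congr (_ * _); apply: eq_bigr => i _; rewrite !mxE.
    by apply: eq_bigr => j _; rewrite !mxE mulrC.
  rewrite bigA_distr_bigA mulr_sumr; apply: eq_bigr => f _.
  rewrite mulrCA big_split; congr (_ * (_ * _)).
  by apply: eq_bigr => i _; rewrite !mxE.
have card_r : r`! = #|{: 'S_r}| by rewrite card_Sn.
rewrite card_r -sumr_const.
transitivity (\sum_(t : 'S_r) \sum_(f : {ffun 'I_r -> 'I_n})
    (-1) ^+ t * (\prod_i A i (f (t i))) * \det (colsub f A)).
  apply: eq_bigr => t _; rewrite detE.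
  pose p_ (t : 'S_r) (f : {ffun 'I_r -> 'I_n}) := [ffun i => f (t i)].
  have p_K : cancel (p_ t) (p_ t^-1)%g.
    by move=> f; apply/ffunP => i; rewrite !ffunE permKV.
  have p_K' : cancel (p_ t^-1)%g (p_ t).
    by move=> f; apply/ffunP => i; rewrite !ffunE permK.
  rewrite (reindex (p_ t)); last by apply: onW_bij; exists (p_ t^-1)%g.
  apply: eq_bigr => f _.
  have -> : colsub (p_ t f) A = colsub f A *m perm_mx t^-1.
    by rewrite -col_permE; apply/matrixP=> i j; rewrite !mxE ffunE.
  rewrite det_mulmx det_perm odd_permV [X in _ * X = _]mulrC mulrCA -mulrA.
  congr (_ * (_ * _)).
  by apply: eq_bigr => i _; rewrite ffunE.
rewrite exchange_big; apply: eq_bigr => f _ /=.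
rewrite -mulr_suml expr2; congr (_ * _).
rewrite /determinant; apply: eq_bigr => t _; congr (_ * _).
by apply: eq_bigr => i _; rewrite !mxE.
Qed.

(** Cauchy-Binet for A A^T. The summand of a set is given by any of its
    enumerations, so that no enumeration has to be chosen: in the sum over all
    functions, those that are not injective contribute zero and each set is
    enumerated by r! injections. *)
Lemma cauchy_binet_tr (w : {set 'I_n} -> R) :
  (forall f : 'I_r -> 'I_n, injective f ->
     w [set f i | i : 'I_r] = \det (colsub f A) ^+ 2) ->
  \det (A *m A^T) = \sum_(S : {set 'I_n} | #|S| == r) w S.
Proof.
move=> wE; have r_inj : injective (fun x : R => x *+ r`!).
  by move=> x y /eqP; rewrite eqr_pMn2r ?fact_gt0 // => /eqP.
apply: r_inj; rewrite det_mul_tr_ffun /= -sumrMnl.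
rewrite (bigID (fun f : {ffun _ -> _} => injectiveb f)) /= [X in _ + X]big1.
  rewrite addr0 (partition_big
    (fun f : {ffun 'I_r -> 'I_n} => [set f i | i : 'I_r])
    (fun S => #|S| == r)) /=; last first.
    by move=> f /injectiveP f_inj; rewrite card_imset // card_ord.
  apply: eq_bigr => S /eqP S_r.
  have := card_inj_ffuns_on 'I_r (mem S).
  rewrite card_ord S_r ffactnn => <-.
  rewrite -sumr_const; apply: eq_big => f.
    rewrite !inE andbC; case: injectiveP => f_inj; rewrite ?andbF // !andbT.
    rewrite eqEcard card_imset // card_ord S_r leqnn andbT.
    apply/subsetP/ffun_onP => [fS i|fS x /imsetP[i _ ->] //].
    by apply/fS/imset_f.
  by case/andP=> /injectiveP f_inj /eqP <-; rewrite wE.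
move=> f /injectivePn[i [j ij fij]].
have -> : \det (colsub f A) = 0; last by rewrite expr0n.
rewrite -det_tr; apply: (determinant_alternate ij) => k.
by rewrite !mxE fij.
Qed.
End CauchyBinet.

(** Both sides are X^r times the determinant of the block matrix with blocks
    X, A, B and 1, after clearing one of the off-diagonal blocks. *)
Lemma char_poly_mulmxC (R : comNzRingType) (m r : nat)
    (A : 'M[R]_(m, r)) (B : 'M[R]_(r, m)) :
  'X^r * char_poly (A *m B) = 'X^m * char_poly (B *m A).
Proof.
pose A' := map_mx polyC A; pose B' := map_mx polyC B.
have cA : char_poly (A *m B) = \det (block_mx 'X%:M A' B' 1%:M).
  have dL : \det (block_mx 1%:M 0 (- B') 1%:M : 'M_(m + r)) = 1.
    by rewrite det_lblock !det1 mulr1.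
  rewrite -[RHS]mulr1 -[X in _ = _ * X]dL -det_mulmx.
  rewrite mulmx_block !mulmx1 !mulmx0 mul1mx !add0r subrr mulmxN det_ublock.
  by rewrite det1 mulr1 /char_poly /char_poly_mx map_mxM.
have cB : char_poly (B *m A) * 'X^m =
    \det (block_mx 1%:M 0 (- B') 'X%:M) * \det (block_mx 'X%:M A' B' 1%:M).
  rewrite -det_mulmx mulmx_block !mul1mx !mul0mx !addr0 mulNmx.
  rewrite mul_mx_scalar mul_scalar_mx addNr mulNmx mulmx1 det_ublock det_scalar.
  by rewrite addrC mulrC /char_poly /char_poly_mx map_mxM.
by rewrite [RHS]mulrC cB det_lblock det1 mul1r det_scalar cA.
Qed.

(** * Nonzero eigenvalues *)

Lemma mulXn_inj (R : idomainType) (p q : {poly R}) (i j : nat) :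
  'X^i * p = 'X^j * q -> p.[0] != 0 -> q.[0] != 0 -> p = q.
Proof.
wlog le_ij : p q i j / (i <= j)%N => [th|].
  case/orP: (leq_total i j) => le_ij; first exact: th.
  by move=> /esym e p0 q0; apply/esym/(th q p j i).
rewrite -(subnKC le_ij) exprD -mulrA => /(mulfI _) ->; last first.
  by rewrite expf_neq0 ?polyX_eq0.
case: (j - i)%N => [|l]; first by rewrite mul1r.
by rewrite exprS -mulrA hornerM hornerX mul0r eqxx.
Qed.

(** Since det D is nonzero, char_poly D is char_poly A without its roots 0, and
    both products are read off from the constant coefficient. *)
Lemma prod_nonzero_roots (R : idomainType) (m r : nat) (A : 'M[R]_m)
    (D : 'M[R]_r) (s : seq R) :
  'X^r * char_poly A = 'X^m * char_poly D -> \det D != 0 ->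
  char_poly A = \prod_(a <- s) ('X - a%:P) ->
  \prod_(a <- s | a != 0) a = \det D.
Proof.
move=> AD D0 sA; pose s1 := [seq a <- s | a != 0].
have sE : \prod_(a <- s) ('X - a%:P) =
    'X^(count (pred1 0) s) * \prod_(a <- s1) ('X - a%:P).
  rewrite (bigID (pred1 0)) /= big_filter; congr (_ * _).
  rewrite (eq_bigr (fun=> 'X)) => [|a /eqP ->]; last by rewrite subr0.
  by rewrite big_const_seq iter_mulr_1.
have s1_0 : (\prod_(a <- s1) ('X - a%:P)).[0] =
    (-1) ^+ size s1 * \prod_(a <- s1) a.
  rewrite horner_prod -[size s1]count_predT -[_ ^+ _]mulr1 -iter_mulr.
  rewrite -big_const_seq -big_split /=; apply: eq_bigr => a _.
  by rewrite hornerXsubC sub0r mulN1r.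
have D_0 : (char_poly D).[0] = (-1) ^+ r * \det D.
  by rewrite horner_coef0 char_poly_det.
have p0 : \prod_(a <- s1) a != 0.
  by rewrite prodf_seq_neq0; apply/allP => a; rewrite mem_filter => /andP[].
have e : \prod_(a <- s1) ('X - a%:P) = char_poly D.
  apply: (@mulXn_inj _ _ _ (r + count (pred1 0) s) m).
  - by rewrite exprD -mulrA -sE -sA AD.
  - by rewrite s1_0 mulf_neq0 // signr_eq0.
  - by rewrite D_0 mulf_neq0 // signr_eq0.
have sz : size s1 = r.
  have := congr1 (size \o polyseq) e.
  by rewrite /= size_prod_XsubC size_char_poly => -[].
move: D_0; rewrite -e s1_0 sz => /(mulfI _) <-; last by rewrite signr_eq0.
by rewrite big_filter.
Qed.

Lemma char_poly_conj (R : fieldType) (n : nat) (P D : 'M[R]_n) :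
  P \in unitmx -> char_poly (invmx P *m D *m P) = char_poly D.
Proof.
move=> P_unit; have := char_poly_mulmxC (invmx P *m D) P.
rewrite mulmxA (mulmxV P_unit) mul1mx => /(mulfI _) -> //.
by rewrite expf_neq0 ?polyX_eq0.
Qed.

(** Over the complex numbers the matrix is hermitian, hence similar to a real
    diagonal matrix. *)
Lemma symmetric_eigenvalue_list (R : realType) (n : nat) (A : 'M[R]_n) :
  A^T = A -> exists s : seq R, eigenvalue_list A s.
Proof.
move=> A_sym; pose AC := map_mx (real_complex R) A.
have AC_herm : AC \is hermsymmx.
  apply/is_hermitianmxP; rewrite expr0 scale1r; apply/matrixP => i j.
  by rewrite !mxE -{1}A_sym mxE; exact/esym/conjc_real.
have /hermitian_normalmx /orthomx_spectralP AC_eq := AC_herm.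
have /mxOverP sp_real := hermitian_spectral_diag_real AC_herm.
exists [seq complex.Re (spectral_diag AC 0 i) | i : 'I_n].
rewrite /eigenvalue_list; apply: (map_poly_inj (real_complex R)).
rewrite map_char_poly rmorph_prod /= big_map enumT -/AC.
transitivity (char_poly (diag_mx (spectral_diag AC))).
  by rewrite {1}AC_eq (char_poly_conj _ (spectral_unit AC)).
rewrite char_poly_trig ?diag_mx_is_trig //; apply: eq_bigr => i _.
rewrite mxE eqxx mulr1n rmorphB /= map_polyX map_polyC /=.
by rewrite RRe_real.
Qed.

(** * Column selections of a factored matrix *)

Lemma qrankM_maxl (m n p : nat) (A : 'M[int]_(m, n)) (B : 'M[int]_(n, p)) :
  (qrank (A *m B) <= qrank A)%N.
Proof. by rewrite /qrank map_mxM mxrankM_maxl. Qed.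

Lemma qrankM_maxr (m n p : nat) (A : 'M[int]_(m, n)) (B : 'M[int]_(n, p)) :
  (qrank (A *m B) <= qrank B)%N.
Proof. by rewrite /qrank map_mxM mxrankM_maxr. Qed.

(** A matrix of full row rank over the rationals contains a column basis. *)
Lemma exists_nonzero_minor (r n : nat) (Z : 'M[int]_(r, n)) :
  qrank Z = r -> exists2 f : 'I_r -> 'I_n, injective f & \det (colsub f Z) != 0.
Proof.
move=> rkZ; pose ZQ : 'M[rat]_(r, n) := map_mx intr Z.
have ZQ_full : row_full ZQ^T by rewrite /row_full mxrank_tr; apply/eqP.
exists (fullrankfun ZQ_full); first exact: fullrankfun_inj.
rewrite -(intr_eq0 rat) -det_map_mx -unitfE -unitmxE map_mxsub.
by rewrite -unitmx_tr trmx_mxsub fullrowsub_unit.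
Qed.

(** Two enumerations of the same set of columns differ by a permutation matrix.
    The lengths r and q are equal, but keeping them apart avoids casts when g
    runs over a set of faces. *)
Lemma colsub_same_image (r q n : nat) (f : 'I_r -> 'I_n) (g : 'I_q -> 'I_n) :
  injective f -> injective g ->
  [set f i | i : 'I_r] = [set g j | j : 'I_q] ->
  exists (G : 'M[int]_(r, q)) (G' : 'M[int]_(q, r)), G *m G' = 1%:M /\
    forall l (A : 'M[int]_(l, n)), colsub g A = colsub f A *m G.
Proof.
move=> f_inj g_inj fg.
have /fin_all_exists[h hE] : forall j, exists i, g j = f i.
  by move=> j; have /imsetP[i _ e] : g j \in [set f i | i : 'I_r];
    [rewrite fg imset_f | exists i].
have /fin_all_exists[h' h'E] : forall i, exists j, f i = g j.
  by move=> i; have /imsetP[j _ e] : f i \in [set g j | j : 'I_q];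
    [rewrite -fg imset_f | exists j].
exists (colsub h 1%:M), (colsub h' 1%:M); split.
  rewrite mulmx_colsub mulmx1; apply/matrixP=> i j; rewrite !mxE.
  by congr (i == _)%:R; apply: f_inj; rewrite -hE -h'E.
move=> l A; rewrite mulmx_colsub mulmx1.
by apply/matrixP=> i j; rewrite !mxE hE.
Qed.

(** A matrix B E Z as in the Smith form, restricted to the columns selected by
    g. The enumeration f of the same columns has the length r of the middle
    factor, so that the minor of Z is a determinant without casts. *)
Section ColumnSelection.
Variables (p m n r q : nat) (B : 'M[int]_(m, r)) (B' : 'M[int]_(r, m)).
Variables (E : 'M[int]_r) (Z : 'M[int]_(r, n)).
Variables (f : 'I_r -> 'I_n) (g : 'I_q -> 'I_n).
Hypotheses (B'B : B' *m B = 1%:M) (E0 : \det E != 0).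
Hypotheses (f_inj : injective f) (g_inj : injective g).
Hypothesis fg : [set f i | i : 'I_r] = [set g j | j : 'I_q].
Let M := B *m E *m Z.

(** A set of r columns of B E Z is a basis of the column space iff the
    corresponding minor of Z is nonzero. *)
Lemma qrank_colsub : (qrank (colsub g M) == r) = (\det (colsub f Z) != 0).
Proof.
have [G [G' [GG' gG]]] := colsub_same_image f_inj g_inj fg.
apply/eqP/idP => [rkM | Zf0].
  rewrite det_neq0_qrank eqn_leq {1}/qrank rank_leq_row /= -{1}rkM gG.
  apply: leq_trans (qrankM_maxl _ _) _.
  by rewrite /M -mulmx_colsub qrankM_maxr.
rewrite gG /M -mulmx_colsub -(mulmxA B).
by apply: qrank_factor B'B GG' _; rewrite det_mulmx mulf_neq0.
Qed.

Lemma torsion_order_colsub (N : 'M[int]_(p, m)) :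
  N *m M = 0 -> \det (colsub f Z) != 0 ->
  torsion_order (homology_of N (colsub g M)) =
    (`|\det E| * `|\det (colsub f Z)|)%N.
Proof.
move=> NM Zf0; have [G [G' [GG' gG]]] := colsub_same_image f_inj g_inj fg.
rewrite -abszM -det_mulmx; apply: torsion_order_factor B'B GG' _ _.
- by rewrite mulmx_colsub NM; apply/matrixP=> i j; rewrite !mxE.
- by rewrite det_mulmx mulf_neq0.
by rewrite gG /M -mulmx_colsub mulmxA.
Qed.
End ColumnSelection.

Section SquaredMinor.
Variables (r n : nat) (A : 'M[int]_(r, n)).

Lemma det_colsub_same_image (f g : 'I_r -> 'I_n) :
  injective f -> injective g -> [set f i | i : 'I_r] = [set g i | i : 'I_r] ->
  \det (colsub f A) ^+ 2 = \det (colsub g A) ^+ 2.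
Proof.
move=> f_inj g_inj fg.
have [G [G' [/absz_det_inverse detG gG]]] := colsub_same_image f_inj g_inj fg.
rewrite gG det_mulmx exprMn -[X in _ * X]real_normK ?num_real // -abszE detG.
by rewrite expr1n mulr1.
Qed.

(** The square makes the minor independent of the order of the columns; the
    value 0 is for the sets that do not have r elements. *)
Definition squared_minor (S : {set 'I_n}) : int :=
  if [pick f : {ffun 'I_r -> 'I_n} | injectiveb f & [set f i | i : 'I_r] == S]
  is Some f then \det (colsub f A) ^+ 2 else 0.

Lemma squared_minorE (f : 'I_r -> 'I_n) :
  injective f -> squared_minor [set f i | i : 'I_r] = \det (colsub f A) ^+ 2.
Proof.
move=> f_inj; rewrite /squared_minor; case: pickP => [g|/(_ (finfun f))].
  by case/andP=> /injectiveP g_inj /eqP gf; apply: det_colsub_same_image.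
case/negP; apply/andP; split.
  by apply/injectiveP => i j; rewrite !ffunE => /f_inj.
by apply/eqP/eq_imset => i; rewrite ffunE.
Qed.

Lemma det_mul_tr_squared_minors :
  \det (A *m A^T) = \sum_(S : {set 'I_n} | #|S| == r) squared_minor S.
Proof. by apply: cauchy_binet_tr; apply: squared_minorE. Qed.
End SquaredMinor.

Lemma enum_injection (r n : nat) (S : {set 'I_n}) : #|S| = r ->
  exists2 f : 'I_r -> 'I_n, injective f & [set f i | i : 'I_r] = S.
Proof.
move=> Sr; subst r; exists enum_val; first exact: enum_val_inj.
apply/setP=> x; apply/imsetP/idP=> [[i _ ->]|xS]; first exact: enum_valP.
by exists (enum_rank_in xS x); rewrite ?enum_rankK_in.
Qed.

(** By Cauchy-Binet these are the sums of the squared maximal minors of C and of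
    K, and complementary sets of coordinates give equal squared minors. *)
Lemma det_split_exact_gram (r n s : nat) (K : 'M[int]_(n, r))
    (C : 'M[int]_(s, n)) :
  split_exact K C -> \det (C *m C^T) = \det (K^T *m K).
Proof.
move=> KC; have [n_def _] := KC.
rewrite -{2}[K]trmxK !det_mul_tr_squared_minors (reindex_inj (@setC_inj _)) /=.
have cardC (S : {set 'I_n}) : (#|~: S| == s) = (#|S| == r).
  by have := cardsC S; rewrite card_ord; lia.
apply: eq_big => [S|S Ss]; first exact: cardC.
have [g g_inj gS] := enum_injection (eqP Ss).
have [h h_inj hS] :
    exists2 h : 'I_r -> 'I_n, injective h & [set h i | i : 'I_r] = S.
  by apply/enum_injection/eqP; rewrite -cardC.
rewrite -gS -[in RHS]hS !squared_minorE //.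
rewrite (complementary_minors KC g_inj h_inj).
  by rewrite -det_tr trmx_mxsub.
move=> i j; have : g j \in ~: S by rewrite -gS imset_f.
by rewrite inE; apply: contraNneq => <-; rewrite -hS imset_f.
Qed.

(** * The relative boundary squares to zero *)

Section Boundary.
Variables (disp : Order.disp_t) (T : finOrderType disp).
Implicit Types (X A U F G S : {set {set T}}) (s t u : {set T}) (v w : T).

Definition incidence (R : comNzRingType) t s : R :=
  \sum_(v in s | s :\ v == t) (-1) ^+ #|[set u in s | (u < v)%O]%SET|.

(** The boundary matrix between two arbitrary sets of faces: unlike for
    a complex pair, rows and columns can be replaced by equal or smaller sets
    of faces. *)
Definition face_boundary (R : comNzRingType) F G : 'M[R]_(#|F|, #|G|) :=
  \matrix_(i, j) incidence R (enum_val i) (enum_val j).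

Lemma boundaryE (R : comNzRingType) X A (l k : int) :
  boundary R X A l k = face_boundary R (rel_faces X A l) (rel_faces X A k).
Proof. by []. Qed.

Lemma homologyE X A (k : int) :
  homology int X A k =
  homology_of (face_boundary int (rel_faces X A (k - 1)) (rel_faces X A k))
    (face_boundary int (rel_faces X A k) (rel_faces X A (k + 1))).
Proof. by []. Qed.

Lemma map_face_boundary (R : comNzRingType) F G :
  face_boundary R F G = map_mx intr (face_boundary int F G).
Proof.
apply/matrixP=> i j; rewrite !mxE rmorph_sum /=; apply: eq_bigr => v _.
by rewrite rmorphXn rmorphN1.
Qed.

Lemma sign_below s v w : v \in s ->
  (-1) ^+ #|[set u in s :\ v | (u < w)%O]%SET| =
  (-1) ^+ (v < w)%O * (-1) ^+ #|[set u in s | (u < w)%O]%SET| :> int.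
Proof.
move=> vs; rewrite (cardsD1 v [set u in s | (u < w)%O]%SET) inE vs /=.
rewrite exprD mulrA -expr2 sqrr_sign mul1r; congr (_ ^+ #|pred_of_set _|).
by apply/setP=> u; rewrite !inE andbA.
Qed.

(** The square of the boundary is zero: removing v and then w from s, or w and
    then v, yields the same face with opposite signs. The set F only has to
    contain the intermediate faces. *)
Lemma incidence_incidence F s t :
  (forall v w, v \in s -> w \in s :\ v -> s :\ v :\ w = t -> s :\ v \in F) ->
  \sum_(u in F) incidence int t u * incidence int u s = 0.
Proof.
move=> Fs; pose sg v : int := (-1) ^+ #|[set u in s | (u < v)%O]%SET|.
pose P v w := [&& v \in s, w \in s :\ v & s :\ v :\ w == t].
(* The contribution of first removing v from s and then w. *)
pose Phi v w : int := if P v w then (-1) ^+ (v < w)%O * (sg v * sg w) else 0.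
have PC v w : P v w = P w v.
  rewrite /P !in_setD1 [w == v]eq_sym; have -> : s :\ v :\ w = s :\ w :\ v.
    by apply/setP=> u; rewrite !inE andbCA.
  by case: (v \in s); case: (w \in s); rewrite ?andbF.
have PhiN v w : Phi v w = - Phi w v.
  rewrite /Phi PC; case: ifP => [/and3P[ws vs _]|_]; last by rewrite oppr0.
  move: vs; rewrite in_setD1 => /andP[vw _].
  rewrite (mulrC (sg v)) -mulNr; congr (_ * _).
  by case: ltgtP vw => //= _ _; rewrite ?opprK ?expr1 ?expr0.
have sum0 : \sum_v \sum_w Phi v w = 0.
  have e : \sum_v \sum_w Phi v w = - \sum_v \sum_w Phi v w.
    rewrite {1}exchange_big /= -sumrN; apply: eq_bigr => w _.
    by rewrite -sumrN; apply: eq_bigr => v _.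
  by lia.
rewrite -[RHS]sum0.
transitivity
  (\sum_(u in F) \sum_(v in s | s :\ v == u) incidence int t u * sg v).
  by apply: eq_bigr => u _; rewrite mulr_sumr.
rewrite (exchange_big_dep (mem s)) /=; last by move=> u v _ /andP[].
rewrite [RHS](bigID (mem s)) /= [X in _ = _ + X]big1 ?addr0; last first.
  by move=> v vs; rewrite big1 // => w _; rewrite /Phi /P (negPf vs).
apply: eq_bigr => v vs.
transitivity (\sum_(u | (s :\ v == u) && (u \in F)) incidence int t u * sg v).
  by apply: eq_bigl => u; rewrite vs andbC.
have PhiE w : Phi v w = if (w \in s :\ v) && (s :\ v :\ w == t)
    then (-1) ^+ #|[set u in s :\ v | (u < w)%O]%SET| * sg v else 0.
  rewrite /Phi /P vs /=; case: ifP => // _; rewrite sign_below // -mulrA.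
  by rewrite [sg v * _]mulrC.
under eq_bigr => w _ do rewrite PhiE.
rewrite -big_mkcond /= -[RHS]mulr_suml -/(incidence int t (s :\ v)).
have [sF|sNF] := boolP (s :\ v \in F).
  rewrite (big_pred1 (s :\ v)) // => u.
  by rewrite [RHS]eq_sym andb_idr // => /eqP <-.
rewrite big_pred0 => [|u]; last by apply/andP => -[/eqP <-]; apply/negP.
rewrite /incidence big_pred0 ?mul0r // => w; apply/negP => /andP[ws /eqP e].
by rewrite (Fs v w) in sNF.
Qed.
End Boundary.

(** * Forests as column bases of the boundary matrix *)

Section Skeletal.
Variables (disp : Order.disp_t) (T : finOrderType disp).
Implicit Types (X A U F G S : {set {set T}}) (s t u : {set T}) (v w : T).

Lemma simplicial_complexP X :
  reflect (finset.set0 \in X /\ forall s t, s \in X -> t \subset s -> t \in X)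
    (simplicial_complex X).
Proof.
apply: (iffP andP) => [[X0 /forall_inP Xs]|[X0 Xs]]; split=> //.
  by move=> s t /Xs /subsetP sX ts; apply: sX; rewrite powersetE.
by apply/forall_inP => s sX; apply/subsetP => t; rewrite powersetE; apply: Xs.
Qed.

Lemma face_dimD1 s v : v \in s -> face_dim (s :\ v) = face_dim s - 1.
Proof. by move=> vs; rewrite /face_dim [in RHS](cardsD1 v) vs; lia. Qed.

Lemma face_dim_subset s t : t \subset s -> face_dim t <= face_dim s.
Proof. by move=> /subset_leq_card; rewrite /face_dim; lia. Qed.

Lemma in_rel_faces X A k s :
  (s \in rel_faces X A k) = [&& s \in X, s \notin A & face_dim s == k].
Proof. by rewrite !inE andbA [(s \in X) && _]andbC. Qed.

Lemma in_skeleton X k s : (s \in skeleton X k) = (s \in X) && (face_dim s <= k).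
Proof. by rewrite inE. Qed.

Lemma skeleton_complex X k :
  -1 <= k -> simplicial_complex X -> simplicial_complex (skeleton X k).
Proof.
move=> k1 /simplicial_complexP[X0 Xs]; apply/simplicial_complexP; split.
  by rewrite in_skeleton X0 /face_dim cards0.
move=> s t; rewrite !in_skeleton => /andP[sX sk] ts.
by rewrite (Xs s) //= (le_trans (face_dim_subset ts)).
Qed.

Lemma face_boundary_sq X A k : simplicial_complex X -> simplicial_complex A ->
  face_boundary int (rel_faces X A (k - 1)) (rel_faces X A k) *m
  face_boundary int (rel_faces X A k) (rel_faces X A (k + 1)) = 0.
Proof.
move=> /simplicial_complexP[_ Xs] /simplicial_complexP[_ As].
apply/matrixP=> i j; rewrite !mxE.
have := enum_valP i; have := enum_valP j.
set t := enum_val i; set s := enum_val j.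
rewrite !in_rel_faces => /and3P[sX sA /eqP sk] /and3P[tX tA /eqP tk].
transitivity
  (\sum_(u in rel_faces X A k) incidence int t u * incidence int u s).
  by rewrite [RHS]big_enum_val; apply: eq_bigr => l _; rewrite !mxE.
apply: incidence_incidence => v w vs ws e; rewrite in_rel_faces.
rewrite (Xs s) ?subD1set //= face_dimD1 // sk addrK eqxx andbT.
by apply: contra tA => /As; apply; rewrite -e subD1set.
Qed.

Lemma bettiE X A k : simplicial_complex X -> simplicial_complex A ->
  (betti X A k +
   qrank (face_boundary int (rel_faces X A (k - 1)) (rel_faces X A k)) +
   qrank (face_boundary int (rel_faces X A k) (rel_faces X A (k + 1))) =
   #|rel_faces X A k|)%N.
Proof. by move=> hX hA; apply/free_rank_homology/face_boundary_sq. Qed.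

Lemma sub_enum S F : S \subset F ->
  exists g : 'I_#|S| -> 'I_#|F|,
    [/\ injective g, forall j, enum_val (g j) = enum_val j
      & [set g j | j : 'I_#|S|] = [set i | enum_val i \in S]].
Proof.
move=> /subsetP SF.
have /fin_all_exists[g gE] :
    forall j : 'I_#|S|, exists i : 'I_#|F|, enum_val i = enum_val j.
  move=> j; have jF := SF _ (enum_valP j).
  by exists (enum_rank_in jF (enum_val j)); rewrite enum_rankK_in.
exists g; split=> //.
  by move=> j j' e; apply: enum_val_inj; rewrite -!gE e.
apply/setP=> i; rewrite inE; apply/imsetP/idP=> [[j _ ->]|iS].
  by rewrite gE enum_valP.
exists (enum_rank_in iS (enum_val i)) => //.
by apply: enum_val_inj; rewrite gE enum_rankK_in.
Qed.

Section Pair.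
Variables (X A : {set {set T}}) (k : int).
Hypotheses (hX : simplicial_complex X) (hA : subcomplex A X) (k1 : -1 <= k).

Let cA : simplicial_complex A. Proof. by case/andP: hA. Qed.
Let sAX s : s \in A -> s \in X.
Proof. by case/andP: hA => _ /subsetP; apply. Qed.
Local Notation F := (rel_faces X A).

(** The conditions on a forest or a tree that do not involve homology. *)
Definition skeletal U : bool :=
  [&& simplicial_complex U, skeleton A k \subset U, U \subset skeleton X k
    & skeleton U (k - 1) == skeleton X (k - 1)].

Lemma skeletal_skeleton : skeletal (skeleton X k).
Proof.
rewrite /skeletal skeleton_complex // subxx /=; apply/andP; split.
  by apply/subsetP => s; rewrite !in_skeleton => /andP[/sAX -> ->].
apply/eqP/setP=> s; rewrite !in_skeleton -andbA; congr (_ && _).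
by apply: andb_idl => sk; apply: le_trans sk _; lia.
Qed.

(** Below dimension k, the complexes U and X have the same faces. *)
Lemma rel_faces_skeletal U (j : int) : skeletal U ->
  rel_faces U (skeleton A k) j =
  if j < k then F j else if j == k then F k :&: U else finset.set0.
Proof.
case/and4P=> _ /subsetP AU /subsetP UX /eqP /setP Uk; apply/setP=> s.
rewrite in_rel_faces; have [jk|kj] := ltP j k.
  rewrite in_rel_faces in_skeleton.
  have [sj|] := eqVneq (face_dim s) j; last by rewrite !andbF.
  have := Uk s; rewrite !in_skeleton sj.
  have -> : (j <= k - 1) = true by lia.
  by rewrite !andbT (ltW jk) andbT => ->.
have [->|jk] := eqVneq j k.
  rewrite in_setI in_rel_faces in_skeleton.
  have [sj|] := eqVneq (face_dim s) k; last by rewrite !andbF.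
  rewrite sj lexx !andbT.
  case: (boolP (s \in U)) => [/UX|]; last by rewrite andbF.
  by rewrite in_skeleton => /andP[->]; rewrite andbT.
rewrite in_set0; apply/negbTE/negP => /and3P[/UX].
rewrite !in_skeleton => /andP[_ sk] _ /eqP sj.
by move: jk; rewrite eq_le kj -sj sk.
Qed.

Lemma skeletal_betti U : skeletal U ->
  (betti U (skeleton A k) k + qrank (face_boundary int (F (k - 1)) (F k :&: U))
   = #|F k :&: U|)%N /\
  (betti U (skeleton A k) (k - 1) +
   qrank (face_boundary int (F (k - 2)) (F (k - 1))) +
   qrank (face_boundary int (F (k - 1)) (F k :&: U)) = #|F (k - 1)|)%N.
Proof.
move=> sU; have /and4P[cU _ _ _] := sU; have cAk := skeleton_complex k1 cA.
have := bettiE k cU cAk; have := bettiE (k - 1) cU cAk.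
have -> : k - 1 - 1 = k - 2 by lia.
rewrite subrK.
rewrite !rel_faces_skeletal //.
have -> : (k - 2 < k) = true by lia.
have -> : (k - 1 < k) = true by lia.
have -> : (k + 1 < k) = false by lia.
have -> : (k + 1 == k) = false by lia.
rewrite ltxx eqxx => e1 e2; split=> //.
rewrite -[RHS]e2 [X in _ = (_ + X)%N](_ : _ = 0%N) ?addn0 //.
by apply/eqP; rewrite -leqn0 (leq_trans (rank_leq_col _)) ?cards0.
Qed.

Lemma rel_faces_setI_skeleton : F k :&: skeleton X k = F k.
Proof.
apply/setIidPl/subsetP => s; rewrite in_rel_faces in_skeleton.
by case/and3P=> -> _ /eqP ->; rewrite lexx.
Qed.

Local Notation M := (face_boundary int (F (k - 1)) (F k)).

Lemma skeletal_counts U : skeletal U ->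
  [/\ (betti U (skeleton A k) k +
       qrank (face_boundary int (F (k - 1)) (F k :&: U)) = #|F k :&: U|)%N,
      (betti U (skeleton A k) (k - 1) +
       qrank (face_boundary int (F (k - 1)) (F k :&: U)) =
       betti X A (k - 1) + qrank M)%N
    & ((fcount U (skeleton A k) k)%:Z
       == (fcount X A k)%:Z - (betti (skeleton X k) (skeleton A k) k)%:Z)
      = (#|F k :&: U| == qrank M)].
Proof.
move=> sU; have [e1 e2] := skeletal_betti sU.
have [e3 _] := skeletal_betti skeletal_skeleton.
rewrite rel_faces_setI_skeleton in e3.
have e4 := bettiE (k - 1) hX cA; rewrite subrK in e4.
have k2 : k - 1 - 1 = k - 2 by lia.
rewrite k2 in e4.
rewrite /fcount rel_faces_skeletal // ltxx eqxx; split=> //; first by lia.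
by apply/eqP/eqP; lia.
Qed.

(** A forest is a basis of the column space of the boundary matrix M: condition
    (a) says that the columns of U are independent, (b) that they have the
    rank of M, and (c) that their number is this rank. *)
Lemma mem_forests U :
  (U \in forests X A k) =
  [&& skeletal U, #|F k :&: U| == qrank M
    & qrank (face_boundary int (F (k - 1)) (F k :&: U)) == qrank M].
Proof.
rewrite inE.
transitivity [&& skeletal U, betti U (skeleton A k) k == 0%N,
    betti U (skeleton A k) (k - 1) == betti X A (k - 1) &
    (fcount U (skeleton A k) k)%:Z
      == (fcount X A k)%:Z - (betti (skeleton X k) (skeleton A k) k)%:Z].
  by rewrite /skeletal -!andbA.
apply: andb_id2l => sU; have [e1 e2 ->] := skeletal_counts sU.
by apply/and3P/andP => [[/eqP ? /eqP ? /eqP ?]|[/eqP ? /eqP ?]]; split;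
  apply/eqP; lia.
Qed.

(** Conditions (a) and (c) already give U the rank of M, so its Betti number in
    dimension k - 1 is that of (X, A). *)
Lemma mem_trees U :
  (U \in trees X A k) = (U \in forests X A k) && (betti X A (k - 1) == 0%N).
Proof.
rewrite mem_forests inE.
transitivity [&& skeletal U, betti U (skeleton A k) k == 0%N,
    betti U (skeleton A k) (k - 1) == 0%N &
    (fcount U (skeleton A k) k)%:Z
      == (fcount X A k)%:Z - (betti (skeleton X k) (skeleton A k) k)%:Z].
  by rewrite /skeletal -!andbA.
rewrite -andbA; apply: andb_id2l => sU; have [e1 e2 ->] := skeletal_counts sU.
rewrite -andbA.
by apply/and3P/and3P => -[/eqP ? /eqP ? /eqP ?]; split; apply/eqP; lia.
Qed.

Definition columns U : {set 'I_#|F k|} := [set i | enum_val i \in U].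

(** The inverse of columns on complexes that satisfy skeletal. *)
Definition complex_of (J : {set 'I_#|F k|}) : {set {set T}} :=
  skeleton X (k - 1) :|: skeleton A k :|: [set enum_val i | i in J].

Lemma in_complex_of J s : (s \in complex_of J) =
  [|| s \in skeleton X (k - 1), s \in skeleton A k
    | s \in [set enum_val i | i in J]].
Proof. by rewrite !in_setU orbA. Qed.

Lemma skeletal_complex_of J : skeletal (complex_of J).
Proof.
have [A0 As] := simplicial_complexP _ (skeleton_complex k1 cA).
have [_ Xs] := simplicial_complexP _ hX.
have JF s : s \in [set enum_val i | i in J] -> s \in F k.
  by case/imsetP=> i _ ->; apply: enum_valP.
apply/and4P; split.
- apply/simplicial_complexP; split=> [|s t].
    by rewrite in_complex_of A0 orbT.
  rewrite !in_complex_of => sU ts.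
  have [tk|tk] := lerP (face_dim t) (k - 1).
    rewrite in_skeleton tk (Xs s) //; case/or3P: sU => [||/JF].
    + by rewrite in_skeleton => /andP[].
    + by rewrite in_skeleton => /andP[/sAX].
    + by rewrite in_rel_faces => /andP[].
  case/or3P: sU => [|sA|sJ].
  + rewrite in_skeleton => /andP[_ sk].
    by have := le_trans (face_dim_subset ts) sk; lia.
  + by rewrite (As s) ?orbT.
  have := JF _ sJ; rewrite in_rel_faces => /and3P[_ _ /eqP sk].
  suff -> : t = s by rewrite sJ !orbT.
  by apply/eqP; rewrite eqEcard ts; move: sk tk; rewrite /face_dim; lia.
- by apply/subsetP => s sA; rewrite in_complex_of sA orbT.
- apply/subsetP => s; rewrite in_complex_of !in_skeleton => /or3P[||/JF].
  + by case/andP=> -> sk; apply: le_trans sk _; lia.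
  + by case/andP=> /sAX -> ->.
  + by rewrite in_rel_faces => /and3P[-> _ /eqP ->]; rewrite lexx.
apply/eqP/setP=> s; rewrite in_skeleton in_complex_of.
have [sk|sk] := boolP (face_dim s <= k - 1); last first.
  by rewrite andbF in_skeleton (negPf sk) andbF.
rewrite andbT; apply: orb_idr => /orP[|/JF].
  by rewrite !in_skeleton sk => /andP[/sAX ->].
by rewrite in_rel_faces => /and3P[_ _ /eqP sk']; move: sk; rewrite sk'; lia.
Qed.

Lemma columns_complex_of J : columns (complex_of J) = J.
Proof.
apply/setP=> i; rewrite inE in_complex_of (mem_imset _ _ enum_val_inj).
have := enum_valP i; rewrite in_rel_faces !in_skeleton.
move=> /and3P[_ /negPf -> /eqP ->].
have -> : (k <= k - 1) = false by lia.
by rewrite andbF.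
Qed.

Lemma complex_of_columns U : skeletal U -> complex_of (columns U) = U.
Proof.
case/and4P=> _ /subsetP AU /subsetP UX /eqP/setP Uk.
apply/setP=> s; rewrite in_complex_of -Uk.
apply/or3P/idP => [[|/AU //|]|sU].
- by rewrite in_skeleton => /andP[].
- by case/imsetP=> i; rewrite inE => iU ->.
have := UX _ sU; rewrite !in_skeleton sU => /andP[sX sk].
have [sk1|sk1] := boolP (face_dim s <= k - 1); first by constructor 1.
have [sA|sA] := boolP (s \in A); first by constructor 2; rewrite sk.
have sF : s \in F k.
  by rewrite in_rel_faces sX sA eq_le sk; move: sk1; lia.
constructor 3; apply/imsetP.
by exists (enum_rank_in sF s); rewrite ?inE enum_rankK_in.
Qed.

Lemma card_columns U : #|columns U| = #|F k :&: U|.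
Proof.
have [g [g_inj _ gE]] := sub_enum (subsetIl (F k) U).
have -> : columns U = [set g j | j : 'I_#|F k :&: U|].
  rewrite gE; apply/setP=> i.
  by rewrite [LHS]in_set [RHS]in_set in_setI enum_valP.
by rewrite card_imset // card_ord.
Qed.

Lemma forest_columns U : U \in forests X A k ->
  exists2 f : 'I_(qrank M) -> 'I_#|F k|, injective f
    & [set f i | i : 'I_(qrank M)] = columns U.
Proof.
rewrite mem_forests => /and3P[_ /eqP Ur _].
by apply: enum_injection; rewrite card_columns.
Qed.

Section Factor.
Variables (B : 'M[int]_(#|F (k - 1)|, qrank M)).
Variables (B' : 'M[int]_(qrank M, #|F (k - 1)|)).
Variables (E : 'M[int]_(qrank M)) (Z : 'M[int]_(qrank M, #|F k|)).
Hypotheses (B'B : B' *m B = 1%:M) (E0 : \det E != 0) (ME : M = B *m E *m Z).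

Lemma face_boundary_sub U : exists g : 'I_#|F k :&: U| -> 'I_#|F k|,
  [/\ injective g, [set g j | j : 'I_#|F k :&: U|] = columns U
    & face_boundary int (F (k - 1)) (F k :&: U) = colsub g M].
Proof.
have [g [g_inj gV gE]] := sub_enum (subsetIl (F k) U).
exists g; split=> //.
  rewrite gE; apply/setP=> i.
  by rewrite [LHS]in_set [RHS]in_set in_setI enum_valP.
by apply/matrixP=> i j; rewrite !mxE gV.
Qed.

Lemma mem_forests_minor U (f : 'I_(qrank M) -> 'I_#|F k|) :
  skeletal U -> injective f -> [set f i | i : 'I_(qrank M)] = columns U ->
  (U \in forests X A k) = (\det (colsub f Z) != 0).
Proof.
move=> sU f_inj fU; rewrite mem_forests sU /=.
have -> : #|F k :&: U| == qrank M.
  by rewrite -card_columns -fU card_imset ?card_ord.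
have [g [g_inj gU ->]] := face_boundary_sub U.
by rewrite -(qrank_colsub Z B'B E0 f_inj g_inj) -?ME ?gU.
Qed.

Lemma forest_torsion_order U (f : 'I_(qrank M) -> 'I_#|F k|) :
  U \in forests X A k -> injective f ->
  [set f i | i : 'I_(qrank M)] = columns U ->
  torsion_order (homology int U (skeleton A k) (k - 1)) =
    (`|\det E| * `|\det (colsub f Z)|)%N.
Proof.
move=> UF f_inj fU; have := UF; rewrite mem_forests => /andP[sU _].
rewrite (mem_forests_minor sU f_inj fU) in UF.
rewrite homologyE subrK !rel_faces_skeletal //.
have -> : (k - 1 - 1 < k) = true by lia.
have -> : (k - 1 < k) = true by lia.
rewrite ltxx eqxx.
have [g [g_inj gU ->]] := face_boundary_sub U.
rewrite {1}ME; apply: (torsion_order_colsub B'B E0 f_inj g_inj _ _ UF).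
  by rewrite fU gU.
have := face_boundary_sq (k - 1) hX cA.
by rewrite subrK -ME.
Qed.

(** The torsion orders of the forests are the nonzero maximal minors of E Z, up
    to sign, and the remaining minors are zero. *)
Lemma sum_forests_torsion_order :
  \sum_(U in forests X A k)
    (torsion_order (homology int U (skeleton A k) (k - 1)))%:Z ^+ 2 =
  \det E ^+ 2 * \det (Z *m Z^T).
Proof.
have -> : \det E ^+ 2 * \det (Z *m Z^T) = \det ((E *m Z) *m (E *m Z)^T).
  rewrite trmx_mul mulmxA -(mulmxA E Z) !det_mulmx det_tr expr2.
  by rewrite [RHS]mulrAC.
pose w J : int := if complex_of J \in forests X A k then
  (torsion_order (homology int (complex_of J) (skeleton A k) (k - 1)))%:Z ^+ 2
  else 0.
rewrite (@cauchy_binet_tr _ _ _ _ w) => [|f f_inj]; last first.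
  have fU := esym (columns_complex_of [set f i | i : 'I_(qrank M)]).
  rewrite /w (mem_forests_minor (skeletal_complex_of _) f_inj fU).
  case: ifP => [Zf0|/negbFE/eqP Zf0].
    rewrite (forest_torsion_order _ f_inj fU); last first.
      by rewrite (mem_forests_minor (skeletal_complex_of _) f_inj fU).
    rewrite -mulmx_colsub det_mulmx -abszM abszE real_normK ?num_real //.
  by rewrite -mulmx_colsub det_mulmx Zf0 mulr0 expr0n.
rewrite -big_mkcondr (reindex_onto complex_of columns) => [|U].
  apply: eq_bigl => J; rewrite columns_complex_of eqxx andbT andb_idl //.
  rewrite mem_forests => /and3P[_ + _].
  by rewrite -card_columns columns_complex_of.
by rewrite mem_forests => /andP[/complex_of_columns].
Qed.
End Factor.
End Pair.
End Skeletal.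

(** * Acyclic pairs *)

(** The Gram determinant is a sum of squares of minors, one of which is not
    zero. *)
Lemma gram_det_neq0 (r n : nat) (Z : 'M[int]_(r, n)) :
  qrank Z = r -> \det (Z *m Z^T) != 0.
Proof.
move=> /exists_nonzero_minor[f _ Zf0].
have : \det (Z *m Z^T) *+ r`! != 0.
  rewrite det_mul_tr_ffun psumr_neq0 => [|g _]; last exact: sqr_ge0.
  apply/hasP; exists (finfun f) => /=; first by rewrite mem_index_enum.
  rewrite lt_neqAle sqr_ge0 eq_sym expf_neq0 //.
  rewrite (_ : colsub _ Z = colsub f Z) //.
  by apply/matrixP=> i j; rewrite !mxE ffunE.
by apply: contraNneq => ->; rewrite mul0rn.
Qed.

Lemma qrank_tr (m n : nat) (M : 'M[int]_(m, n)) : qrank M^T = qrank M.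
Proof. by rewrite /qrank -map_trmx mxrank_tr. Qed.

Lemma qrank_split_inj (m r : nat) (B : 'M[int]_(m, r)) (B' : 'M[int]_(r, m)) :
  B' *m B = 1%:M -> qrank B = r.
Proof.
move=> B'B; have -> : B = B *m 1%:M *m 1%:M by rewrite !mulmx1.
by apply: qrank_factor B'B (mulmx1 1%:M) _; rewrite det1 oner_neq0.
Qed.

Lemma det_gram_rowsub (q m r s n : nat) (h : 'I_q -> 'I_m) (g : 'I_s -> 'I_m)
    (K : 'M[int]_(m, r)) (C : 'M[int]_(s, m)) (P : 'M[int]_(r, n))
    (D := rowsub h (K *m P)) :
  split_exact K C -> injective h -> injective g -> (forall i j, h i != g j) ->
  q = r -> \det (D *m D^T) = \det (colsub g C) ^+ 2 * \det (P *m P^T).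
Proof.
move=> KC h_inj g_inj hg qr; subst q; rewrite /D.
rewrite (complementary_minors KC g_inj h_inj hg).
rewrite -mul_rowsub_mx trmx_mul mulmxA -(mulmxA _ P) !det_mulmx det_tr expr2.
by rewrite mulrAC.
Qed.

(** The k-faces of A count as faces of X relative to G, as G has no k-faces, but
    their boundaries lie in G. So they contribute nothing to the Laplacian. *)
Lemma gram_forest (disp : Order.disp_t) (T : finOrderType disp)
    (X A : {set {set T}}) (k : int) (G : {set {set T}}) :
  subcomplex A X -> skeletal X A (k - 1) G ->
  let D := face_boundary int (rel_faces X A (k - 1) :\: G) (rel_faces X A k) in
  let D' := face_boundary int (rel_faces X G (k - 1)) (rel_faces X G k) in
  \det (D' *m D'^T) = \det (D *m D^T).
Proof.
move=> hA /and4P[_ /subsetP AG /subsetP GX _] D D'; rewrite {}/D {}/D'.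
have kG s : s \in G -> face_dim s <= k - 1.
  by move/GX; rewrite in_skeleton => /andP[].
have <- : rel_faces X G (k - 1) = rel_faces X A (k - 1) :\: G.
  apply/setP=> s; rewrite in_setD !in_rel_faces.
  case: (boolP (s \in G)) => [_|sG] /=; first by rewrite andbF.
  case: (eqVneq (face_dim s) (k - 1)) => [sk|]; last by rewrite !andbF.
  have -> : s \notin A; last by [].
  by apply: contra sG => sA; apply: AG; rewrite in_skeleton sA sk /=.
congr (\det _); apply/matrixP=> i j; rewrite !mxE.
have := enum_valP i; set t := enum_val i; set t' := enum_val j => tQ.
have sumE (S : {set {set T}}) :
    \sum_(l < #|S|) face_boundary int (rel_faces X G (k - 1)) S i l *
      (face_boundary int (rel_faces X G (k - 1)) S)^T l j =
    \sum_(s in S) incidence int t s * incidence int t' s.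
  by rewrite [RHS]big_enum_val; apply: eq_bigr => l _; rewrite !mxE.
rewrite !sumE (bigID (mem A)) /= big1 ?add0r => [|s /andP[sX sA]].
  apply: eq_bigl => s; rewrite !in_rel_faces.
  case: (eqVneq (face_dim s) k) => [sk|]; last by rewrite !andbF.
  have -> : s \notin G; last by rewrite !andbT.
  by apply/negP => /kG; rewrite sk; lia.
rewrite {1}/incidence big_pred0 ?mul0r // => v; apply/negP => /andP[vs /eqP sv].
move: tQ; rewrite in_rel_faces => /and3P[_ /negP tG _]; apply: tG.
move: sX; rewrite in_rel_faces => /and3P[_ _ /eqP sk].
apply: AG; rewrite in_skeleton -sv face_dimD1 // sk lexx andbT.
have /andP[/simplicial_complexP[_ As] _] := hA.
by apply: As sA _; apply: subD1set.
Qed.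

Section Forests.
Variables (disp : Order.disp_t) (T : finOrderType disp) (X A : {set {set T}}).
Hypotheses (hX : simplicial_complex X) (hA : subcomplex A X).
Local Notation F := (rel_faces X A).

Lemma forests_neq0 (k : int) : -1 <= k -> forests X A k != finset.set0.
Proof.
move=> k1; have [c [r [B [Q [e [C [K [BQ KC e0 ME]]]]]]]] :=
  rank_factorization (face_boundary int (F (k - 1)) (F k)).
have [_ [B' [_ [B'B _ _ _ _]]]] := BQ.
have [_ [_ [C' [_ CC' _ _ _]]]] := KC.
have : qrank C = qrank (face_boundary int (F (k - 1)) (F k)).
  rewrite -qrank_tr; apply: (@qrank_split_inj _ _ _ C'^T).
  by rewrite -trmx_mul CC' trmx1.
move=> /exists_nonzero_minor[f f_inj Cf0].
apply/set0Pn; exists (complex_of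
  [set f i | i : 'I_(qrank (face_boundary int (F (k - 1)) (F k)))]).
rewrite (mem_forests_minor hX hA k1 B'B (diag_det_neq0 e0) ME _ f_inj) //.
  exact: skeletal_complex_of.
by rewrite columns_complex_of.
Qed.

Lemma torsion_order_rank_factorization (k : int) (r : nat)
    (M := face_boundary int (F k) (F (k + 1)))
    (B : 'M[int]_(#|F k|, r)) (B' : 'M[int]_(r, #|F k|)) (E : 'M[int]_r)
    (C : 'M[int]_(r, #|F (k + 1)|)) (C' : 'M[int]_(#|F (k + 1)|, r)) :
  B' *m B = 1%:M -> C *m C' = 1%:M -> \det E != 0 -> M = B *m E *m C ->
  torsion_order (homology int X A k) = `|\det E|%N.
Proof.
move=> B'B CC' E0 ME; rewrite homologyE.
apply: torsion_order_factor B'B CC' E0 ME.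
by apply: face_boundary_sq => //; case/andP: hA.
Qed.

Lemma trees_group_order (k : int) U : -1 <= k -> U \in trees X A k ->
  group_order (homology int U (skeleton A k) (k - 1)) =
  torsion_order (homology int U (skeleton A k) (k - 1)).
Proof.
move=> k1; rewrite inE => /and5P[cU _ _ _ /and3P[_ /eqP b0 _]].
rewrite homologyE; apply: group_order_torsion_order => //.
apply: face_boundary_sq => //; apply: skeleton_complex => //.
by case/andP: hA.
Qed.

(** The integral form of both formulas. If the homology in dimension k - 1 has
    rank zero, the number of columns of the kernel basis K equals the rank of
    the boundary matrix in dimension k, and K P is that matrix. *)
Lemma acyclic_factorization (k : int) : 0 <= k -> betti X A (k - 1) = 0%N ->
  let tors Y B j := (torsion_order (homology int Y B j))%:Z in
  exists (r : nat) (K : 'M[int]_(#|F (k - 1)|, r)) (P : 'M[int]_(r, #|F k|)),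
  [/\ face_boundary int (F (k - 1)) (F k) = K *m P,
      \det (P *m P^T) != 0 /\ \det (K^T *m K) != 0,
      \sum_(U in trees X A k)
         (group_order (homology int U (skeleton A k) (k - 1)))%:Z ^+ 2 =
        \det (P *m P^T),
      tors X A (k - 2) != 0 /\
      \sum_(G in forests X A (k - 1)) tors G (skeleton A (k - 1)) (k - 2) ^+ 2 =
        tors X A (k - 2) ^+ 2 * \det (K^T *m K)
    & forall G, G \in forests X A (k - 1) ->
        let D := face_boundary int (F (k - 1) :\: G) (F k) in
        tors G (skeleton A (k - 1)) (k - 2) != 0 /\
        tors X A (k - 2) ^+ 2 * \det (D *m D^T) =
        tors G (skeleton A (k - 1)) (k - 2) ^+ 2 * \det (P *m P^T)].
Proof.
move=> k0 b0 /=; have k1 : -1 <= k by lia.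
have k1' : -1 <= k - 1 by lia.
have cA : simplicial_complex A by case/andP: hA.
have -> : k - 2 = k - 1 - 1 by lia.
have rank_sum := bettiE (k - 1) hX cA; rewrite b0 subrK add0n in rank_sum.
have NM := face_boundary_sq (k - 1) hX cA; rewrite subrK in NM.
set N := face_boundary int (F (k - 1 - 1)) (F (k - 1)) in rank_sum NM.
set M := face_boundary int (F (k - 1)) (F k) in rank_sum NM *.
have [c [r [B [Q [e [C [K [BQ KC e0 NE]]]]]]]] := rank_factorization N.
have [_ [B' [_ [B'B _ _ _ _]]]] := BQ.
have [n_def [K' [C' [K'K CC' _ _ _]]]] := KC.
have [P MP] := smith_kernel B'B e0 KC NE NM.
(* Homology of rank zero: the kernel of N has the rank of M. *)
have rE : r = qrank M by lia.
subst r.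
have P_rank : qrank P = qrank M.
  apply/eqP; rewrite eqn_leq {1}/qrank rank_leq_row /=.
  by have := qrankM_maxr K P; rewrite -MP.
have eN0 := diag_det_neq0 e0.
have torsX :
    torsion_order (homology int X A (k - 1 - 1)) = `|\det (diag_mx e)|%N.
  have := @torsion_order_rank_factorization (k - 1 - 1) _ B B' (diag_mx e).
  by rewrite subrK => /(_ _ _ B'B CC' eN0 NE).
exists (qrank M), K, P; split=> //.
- split; first exact: gram_det_neq0.
  by rewrite -{2}[K]trmxK gram_det_neq0 // qrank_tr (qrank_split_inj K'K).
- transitivity (\sum_(U in forests X A k)
      (torsion_order (homology int U (skeleton A k) (k - 1)))%:Z ^+ 2).
    apply: eq_big => [U|U UT]; first by rewrite mem_trees // b0 andbT.
    by rewrite trees_group_order.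
  have MKP : M = K *m 1%:M *m P by rewrite mulmx1.
  have det1_neq0 : \det (1%:M : 'M[int]_(qrank M)) != 0.
    by rewrite det1 oner_neq0.
  rewrite (sum_forests_torsion_order hX hA k1 K'K det1_neq0 MKP).
  by rewrite det1 expr1n mul1r.
- rewrite torsX; split; first by rewrite eqz_nat absz_eq0.
  rewrite (sum_forests_torsion_order hX hA k1' B'B eN0 NE).
  by rewrite (det_split_exact_gram KC) abszE real_normK ?num_real.
move=> G GF; have [g g_inj gG] := forest_columns hX hA k1' GF.
have := GF; rewrite mem_forests // => /and3P[sG _ _].
have Cg0 : \det (colsub g C) != 0.
  by rewrite -(mem_forests_minor hX hA k1' B'B eN0 NE sG g_inj gG).
rewrite (forest_torsion_order hX hA k1' B'B eN0 NE GF g_inj gG) torsX.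
split; first by rewrite eqz_nat muln_eq0 !absz_eq0 negb_or eN0.
have [h [h_inj hV hE]] := sub_enum (subsetDl (F (k - 1)) G).
have hG : [set h j | j : 'I_#|F (k - 1) :\: G|] = ~: columns X A (k - 1) G.
  rewrite hE; apply/setP=> i.
  by rewrite [LHS]in_set in_setD enum_valP andbT in_setC [in RHS]in_set.
have -> : face_boundary int (F (k - 1) :\: G) (F k) = rowsub h (K *m P).
  by rewrite -MP; apply/matrixP=> i j; rewrite !mxE hV.
rewrite (det_gram_rowsub P KC h_inj g_inj).
- by rewrite PoszM exprMn !abszE !real_normK ?num_real // mulrA.
- move=> i j; have : h i \in ~: columns X A (k - 1) G by rewrite -hG imset_f.
  by rewrite in_setC; apply: contraNneq => ->; rewrite -gG imset_f.
have := cardsC (columns X A (k - 1) G).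
by rewrite -hG -gG !card_imset // !card_ord; move: rank_sum; rewrite /N /M; lia.
Qed.
End Forests.

Theorem theorem1p5 (disp : Order.disp_t) (T : finOrderType disp)
    (R : realType) (X A : {set {set T}}) (d k : int)
    (hX : simplicial_complex X) (hA : subcomplex A X)
    (hd : complex_dim X = d) (hk : 0 <= k <= d) :
  [/\ forests X A k != finset.set0,
      trees X A k \subset forests X A k,
      trees X A k != finset.set0 <-> betti X A (k - 1) = 0%N &
      betti X A (k - 1) = 0%N ->
      (exists2 s : seq R,
         eigenvalue_list (up_down_laplacian R X A (k - 1)) s &
         \prod_(a <- s | a != 0) a =
         (\sum_(U in trees X A k)
            (group_order (homology int U (skeleton A k) (k - 1)))%:R ^+ 2)
         * \sum_(G in forests X A (k - 1))
             (torsion_order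
                (homology int G (skeleton A (k - 1)) (k - 2)))%:R ^+ 2
             / (torsion_order (homology int X A (k - 2)))%:R ^+ 2)
      /\
      (forall G : {set {set T}}, G \in forests X A (k - 1) ->
         \sum_(U in trees X A k)
           (group_order (homology int U (skeleton A k) (k - 1)))%:R ^+ 2 =
         (torsion_order (homology int X A (k - 2)))%:R ^+ 2
         / (torsion_order
              (homology int G (skeleton A (k - 1)) (k - 2)))%:R ^+ 2
         * \det (up_down_laplacian R X G (k - 1)))].
Proof.
have k0 : 0 <= k by case/andP: hk.
have k1 : -1 <= k by lia.
have forests0 := forests_neq0 hX hA k1.
split=> //.
- by apply/subsetP => U; rewrite mem_trees // => /andP[].
- split=> [/set0Pn[U]|b0]; first by rewrite mem_trees // => /andP[_ /eqP].
  case/set0Pn: forests0 => U UF; apply/set0Pn; exists U.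
  by rewrite mem_trees // UF b0.
move=> b0.
have [r [K [P [MP [PP0 KK0] sumU [tX0 sumG] GP]]]] :=
  acyclic_factorization hX hA k0 b0.
pose iR (z : int) : R := z%:~R.
have sumUR : \sum_(U in trees X A k)
    (group_order (homology int U (skeleton A k) (k - 1)))%:R ^+ 2 =
    iR (\det (P *m P^T)).
  rewrite -sumU /iR rmorph_sum; apply: eq_bigr => U _.
  by rewrite rmorphXn.
rewrite sumUR; split; last first.
  move=> G GF; have [tG0 GE] := GP G GF.
  set D := face_boundary int _ _ in GE.
  have -> : \det (up_down_laplacian R X G (k - 1)) = iR (\det (D *m D^T)).
    have := GF; rewrite mem_forests //; last by lia.
    move=> /andP[sG _].
    rewrite -(gram_forest hA sG) /iR -det_map_mx map_mxM -map_trmx.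
    by rewrite -map_face_boundary /up_down_laplacian boundaryE subrK.
  have /(congr1 iR) := GE.
  rewrite /iR [LHS]rmorphM [RHS]rmorphM !rmorphXn /= => GE'.
  rewrite mulrAC; apply: (canRL (mulfK _)).
    by rewrite expf_neq0 // pnatr_eq0; move: tG0; rewrite eqz_nat.
  by rewrite mulrC -GE'.
have := @symmetric_eigenvalue_list R _ (up_down_laplacian R X A (k - 1)).
rewrite /up_down_laplacian trmx_mul trmxK => /(_ erefl)[s sE]; exists s => //.
rewrite -mulr_suml -[X in _ = _ * X](_ : iR (\det (K^T *m K)) = _); last first.
  apply: (canRL (mulfK _)).
    by rewrite expf_neq0 // pnatr_eq0; move: tX0; rewrite eqz_nat.
  have /(congr1 iR) := sumG; rewrite /iR rmorphM rmorphXn /= mulrC => <-.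
  by rewrite rmorph_sum; apply: eq_bigr => G _; rewrite rmorphXn.
pose KR := map_mx iR K; pose PR := map_mx iR P.
have LE : boundary R X A (k - 1) (k - 1 + 1) *m
    (boundary R X A (k - 1) (k - 1 + 1))^T = KR *m (PR *m PR^T *m KR^T).
  rewrite boundaryE subrK map_face_boundary MP map_mxM trmx_mul.
  by rewrite !mulmxA.
have DE : \det (PR *m PR^T *m KR^T *m KR) =
    iR (\det (P *m P^T)) * iR (\det (K^T *m K)).
  rewrite -(mulmxA _ KR^T) det_mulmx /iR -!det_map_mx !map_mxM -!map_trmx.
  by [].
rewrite -DE; apply: (prod_nonzero_roots _ _ sE).
  by rewrite LE char_poly_mulmxC.
by rewrite DE mulf_neq0 // intr_eq0.
Qed.
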